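(* Let $F$ be a field and let $n\ge 3$ be an integer. Then for a group $H$ the following conditions are equivalent: (1) $H\equiv \mathrm{SL}_n(F)$; (2) $H\cong \mathrm{SL}_n(L)$ for some field $L$ such that $F\equiv L$.
   Context: $\equiv$ denotes elementary equivalence (satisfying the same first-order sentences), in the language of groups for groups and in the language of rings for fields. *)

(* Defs.v *)
From HB Require Import structures.
From mathcomp Require Import all_boot all_order all_algebra.

Set Implicit Arguments.
Unset Strict Implicit.
Unset Printing Implicit Defensive.

Import GRing.Theory.
Local Open Scope ring_scope.

(** * First-order logic over a language of function symbols *)

Record language := Language {
  symbol :> Type;
  arity : symbol -> nat
}.

Record structure (L : language) := Structure {
  carrier :> Type;
  interp : forall f : L, ('I_(arity f) -> carrier) -> carrier
}.

Inductive term (L : language) (V : Type) : Type :=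
| Var of V
| App (f : L) of ('I_(arity f) -> term L V).

(* Well-scoped de Bruijn syntax: [formula L V] is the type of formulas whose
   free variables are in [V]. Under a quantifier the free variables are in
   [option V], where [None] is the bound variable and [Some v] is the outer
   variable [v]. *)
Inductive formula (L : language) (V : Type) : Type :=
| Bot
| Eq of term L V & term L V
| And of formula L V & formula L V
| Or of formula L V & formula L V
| Imp of formula L V & formula L V
| All of formula L (option V)
| Ex of formula L (option V).

Arguments Var {L V}.
Arguments App {L V} f args.
Arguments Bot {L V}.

Definition sentence (L : language) := formula L void.

Fixpoint eval (L : language) (M : structure L) (V : Type) (e : V -> M)
    (t : term L V) : M :=
  match t with
  | Var v => e v
  | App f args => interp (fun i => eval e (args i))
  end.

(* [oapp e x] sends [None] to [x] and [Some v] to [e v]. *)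
Fixpoint holds (L : language) (M : structure L) (V : Type) (e : V -> M)
    (phi : formula L V) : Prop :=
  match phi with
  | Bot => False
  | Eq t u => eval e t = eval e u
  | And p q => holds e p /\ holds e q
  | Or p q => holds e p \/ holds e q
  | Imp p q => holds e p -> holds e q
  | All p => forall x : M, holds (oapp e x) p
  | Ex p => exists x : M, holds (oapp e x) p
  end.

Definition satisfies (L : language) (M : structure L) (phi : sentence L) :=
  holds (of_void M) phi.

Definition elem_equiv (L : language) (M N : structure L) : Prop :=
  forall phi : sentence L, satisfies M phi <-> satisfies N phi.

(** * The languages of groups and of rings *)

Variant group_symbol := GOne | GInv | GMul.

Definition group_arity (f : group_symbol) : nat :=
  match f with GOne => 0 | GInv => 1 | GMul => 2 end.

Definition group_language := Language group_arity.

Definition group_interp (G : groupType) (f : group_symbol) :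
    ('I_(group_arity f) -> G) -> G :=
  match f return ('I_(group_arity f) -> G) -> G with
  | GOne => fun _ => 1%g
  | GInv => fun a => (a ord0)^-1%g
  | GMul => fun a => (a ord0 * a ord_max)%g
  end.

Definition group_structure (G : groupType) : structure group_language :=
  @Structure group_language G (@group_interp G).

Variant ring_symbol := RZero | ROne | ROpp | RAdd | RMul.

Definition ring_arity (f : ring_symbol) : nat :=
  match f with RZero | ROne => 0 | ROpp => 1 | RAdd | RMul => 2 end.

Definition ring_language := Language ring_arity.

Definition ring_interp (R : nzRingType) (f : ring_symbol) :
    ('I_(ring_arity f) -> R) -> R :=
  match f return ('I_(ring_arity f) -> R) -> R with
  | RZero => fun _ => 0
  | ROne => fun _ => 1
  | ROpp => fun a => - a ord0
  | RAdd => fun a => a ord0 + a ord_max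
  | RMul => fun a => a ord0 * a ord_max
  end.

Definition ring_structure (R : nzRingType) : structure ring_language :=
  @Structure ring_language R (@ring_interp R).

(** * Special linear groups *)

Record SL (n : nat) (F : fieldType) := MkSL {
  SLval :> 'M[F]_n;
  _ : \det SLval == 1
}.

HB.instance Definition _ n F := [isSub for @SLval n F].
HB.instance Definition _ n F := [Choice of SL n F by <:].

Section SLGroup.
Variables (n : nat) (F : fieldType).
Implicit Types A B C : SL n F.

Fact det_SL A : \det A = 1.
Proof. by apply/eqP; case: A. Qed.

Fact SL_unitmx A : (A : 'M[F]_n) \in unitmx.
Proof. by rewrite unitmxE det_SL unitr1. Qed.

Fact SL_one_subproof : \det (1%:M : 'M[F]_n) == 1.
Proof. by rewrite det1. Qed.

Fact SL_inv_subproof A : \det (invmx A) == 1.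
Proof. by rewrite det_inv det_SL invr1. Qed.

Fact SL_mul_subproof A B : \det (A *m B) == 1.
Proof. by rewrite det_mulmx !det_SL mulr1. Qed.

Definition SL_one := MkSL SL_one_subproof.
Definition SL_inv A := MkSL (SL_inv_subproof A).
Definition SL_mul A B := MkSL (SL_mul_subproof A B).

Fact SL_mulA : associative SL_mul.
Proof. by move=> A B C; apply: val_inj; apply: mulmxA. Qed.

Fact SL_mul1 : left_id SL_one SL_mul.
Proof. by move=> A; apply: val_inj; apply: mul1mx. Qed.

Fact SL_mulr1 : right_id SL_one SL_mul.
Proof. by move=> A; apply: val_inj; apply: mulmx1. Qed.

Fact SL_mulV : left_inverse SL_one SL_inv SL_mul.
Proof. by move=> A; apply: val_inj; apply: mulVmx; apply: SL_unitmx. Qed.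

Fact SL_mulrV : right_inverse SL_one SL_inv SL_mul.
Proof. by move=> A; apply: val_inj; apply: mulmxV; apply: SL_unitmx. Qed.

HB.instance Definition _ := isGroup.Build (SL n F)
  SL_mulA SL_mul1 SL_mulr1 SL_mulV SL_mulrV.

End SLGroup.

Definition group_isomorphic (G H : groupType) : Prop :=
  exists f : {multiplicative G -> H}, bijective f.

(* Main.v *)
From HB Require Import structures.
From Stdlib Require Import FunctionalExtensionality IndefiniteDescription Setoid Classical.
Require Import Defs.
From mathcomp Require Import all_boot all_order all_fingroup all_algebra.
From mathcomp Require Import ring zify.

Set Implicit Arguments.
Unset Strict Implicit.
Unset Printing Implicit Defensive.

Import GRing.Theory.
Local Open Scope ring_scope.

(** A field and its special linear group determine each other by first-order
   means, uniformly enough for elementary equivalence to pass both ways.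

   Matrix entries interpret [SL n L] in [L] by formulas that do not depend on
   [L], so [F] and [L] elementarily equivalent makes [SL n F] and [SL n L]
   elementarily equivalent ([SL_elem_equiv]).  This is the implication from the
   isomorphism.

   Conversely, let [H] be elementarily equivalent to [SL n F].  In [SL n F] the
   field is visible on one root subgroup: the elements [1 + a E_(0,max)]
   multiply by adding the [a], and the commutator of [1 + a E_(0,1)] and
   [1 + b E_(1,max)] is [1 + a b E_(0,max)].  The parameters needed are the
   element with [a = 1] and elements that conjugate this root subgroup to the
   other ones.  The condition [SL_frame] on parameters is first-order and asks
   for four things: these operations define a field; the Steinberg relations
   hold; the coordinate elements are unipotent; every group element is a
   product of root elements along one fixed word, and such products multiply in
   the group as the corresponding products of elementary matrices do over the
   coordinate field.  The last clause is first-order because Gaussian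
   elimination needs a number of steps that depends only on [n]
   ([bounded_generation]) and because statements about the coordinate field are
   statements about the group ([coord_interpretation]).  It forces any group
   with a frame to be [SL n L], where [L] is its coordinate field
   ([presented_iso]).  As [SL n F] has a frame, so does [H].

   It remains to see that [L] is elementarily equivalent to [F].  This holds
   because every frame of [SL n F], however strange, has a coordinate field
   isomorphic to [F] ([rigid_code]): a ring sentence true in [F] is then true in
   the coordinate field of every frame of [SL n F], which is a sentence about
   groups and passes to [H].  For the rigidity, the root elements [x_ij] with
   [i < j] are unipotent matrices with the commutator relations of the
   unitriangular group.  They therefore stabilize a full flag of the natural
   module, and the longest possible commutators, which are the coordinate
   elements, have the form [1 + a N] with a single matrix [N] of rank one
   ([top_height_proportional]).  Conversely each [1 + a N] commutes with all that
   commutes with [1 + N], hence is a coordinate element.  Unipotence itself is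
   enforced by conditions that depend on the characteristic of [F]: exponent [r]
   in characteristic [r], and conjugacy with the first few powers in
   characteristic zero ([unipotent_of_power_traces]). *)

Section Renaming.
Variable A : language.

Fixpoint trename V W (f : V -> W) (t : term A V) : term A W :=
  match t with
  | Var v => Var (f v)
  | App g args => App g (fun i => trename f (args i))
  end.

Fixpoint frename V W (f : V -> W) (phi : formula A V) : formula A W :=
  match phi with
  | Bot => Bot
  | Eq t u => Eq (trename f t) (trename f u)
  | And p q => And (frename f p) (frename f q)
  | Or p q => Or (frename f p) (frename f q)
  | Imp p q => Imp (frename f p) (frename f q)
  | All p => All (frename (omap f) p)
  | Ex p => Ex (frename (omap f) p)
  end.

Variable M : structure A.

Lemma eval_rename V W (f : V -> W) (e : W -> M) (t : term A V) :
  eval e (trename f t) = eval (e \o f) t.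
Proof.
elim: t => [v|g args IH] //=.
by congr interp; apply: functional_extensionality.
Qed.

Lemma holds_rename V (phi : formula A V) W (f : V -> W) (e : W -> M) :
  holds e (frename f phi) <-> holds (e \o f) phi.
Proof.
have oappf U T (g : U -> T) (e' : T -> M) x :
    oapp e' x \o omap g = oapp (e' \o g) x.
  by apply: functional_extensionality; case.
elim: phi W f e => {V} [V|V t u|V p IHp q IHq|V p IHp q IHq|V p IHp q IHq
  |V p IHp|V p IHp] W f e //=.
- by rewrite !eval_rename.
- by rewrite IHp IHq.
- by rewrite IHp IHq.
- by rewrite IHp IHq.
- by split=> H x; move: (H x); rewrite IHp oappf.
- by split=> -[x]; [rewrite IHp oappf|rewrite -oappf -IHp]; exists x.
Qed.

End Renaming.

Definition join (V W T : Type) (e : V -> T) (d : W -> T) (x : V + W) : T :=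
  match x with inl v => e v | inr w => d w end.

Section Definability.
Variables (A : language) (S : Type) (M : S -> structure A).

(** The formula may not depend on the structure [M s]: definability is uniform
   over the whole family. *)
Definition definable V (P : forall s, (V -> M s) -> Prop) :=
  exists phi : formula A V, forall s e, holds e phi <-> P s e.

Definition tdefinable V (f : forall s, (V -> M s) -> M s) :=
  exists t : term A V, forall s e, eval e t = f s e.

Lemma def_ext V (P Q : forall s, (V -> M s) -> Prop) :
  (forall s e, P s e <-> Q s e) -> definable P -> definable Q.
Proof. by move=> PQ [phi Hphi]; exists phi => s e; rewrite Hphi. Qed.

Lemma tdef_ext V (f g : forall s, (V -> M s) -> M s) :
  (forall s e, f s e = g s e) -> tdefinable f -> tdefinable g.
Proof. by move=> fg [t Ht]; exists t => s e; rewrite Ht. Qed.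

Lemma tdef_var V (v : V) : tdefinable (fun s e => e v).
Proof. by exists (Var v). Qed.

Lemma def_rename V W (r : V -> W) (P : forall s, (V -> M s) -> Prop) :
  definable P -> definable (fun s (e : W -> M s) => P s (e \o r)).
Proof.
by move=> [phi Hphi]; exists (frename r phi) => s e; rewrite holds_rename Hphi.
Qed.

Lemma def_holds V (phi : formula A V) : definable (fun s (e : V -> M s) => holds e phi).
Proof. by exists phi. Qed.

Lemma def_holds_rename V W (r : V -> W) (phi : formula A V) :
  definable (fun s (e : W -> M s) => holds (e \o r) phi).
Proof. by exists (frename r phi) => s e; rewrite holds_rename. Qed.

Lemma def_bot V : definable (fun s (_ : V -> M s) => False).
Proof. by exists Bot. Qed.

Lemma def_eq V (f g : forall s, (V -> M s) -> M s) :
  tdefinable f -> tdefinable g -> definable (fun s e => f s e = g s e).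
Proof. by move=> [t Ht] [u Hu]; exists (Eq t u) => s e /=; rewrite Ht Hu. Qed.

Section Connectives.
Variables (V : Type) (P Q : forall s, (V -> M s) -> Prop).
Hypotheses (defP : definable P) (defQ : definable Q).

Lemma def_and : definable (fun s e => P e /\ Q e).
Proof.
by case: defP defQ => p Hp [q Hq]; exists (And p q) => s e /=; rewrite Hp Hq.
Qed.

Lemma def_imp : definable (fun s e => P e -> Q e).
Proof.
by case: defP defQ => p Hp [q Hq]; exists (Imp p q) => s e /=; rewrite Hp Hq.
Qed.

End Connectives.

Lemma def_not V (P : forall s, (V -> M s) -> Prop) :
  definable P -> definable (fun s e => ~ P s e).
Proof. by move=> dP; apply: def_imp dP (def_bot V). Qed.

Lemma def_iff V (P Q : forall s, (V -> M s) -> Prop) :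
  definable P -> definable Q -> definable (fun s e => P s e <-> Q s e).
Proof. by move=> dP dQ; apply: def_and; apply: def_imp. Qed.

Lemma def_all V (P : forall s, (V -> M s) -> M s -> Prop) :
  definable (fun s (e : option V -> M s) => P s (e \o Some) (e None)) ->
  definable (fun s e => forall x, P s e x).
Proof. by move=> [p Hp]; exists (All p) => s e /=; split=> H x;
   apply/(Hp s (oapp e x)); apply: H.
Qed.

Lemma def_ex V (P : forall s, (V -> M s) -> M s -> Prop) :
  definable (fun s (e : option V -> M s) => P s (e \o Some) (e None)) ->
  definable (fun s e => exists x, P s e x).
Proof.
by move=> [p Hp]; exists (Ex p) => s e /=; split=> -[x Hx]; exists x;
   apply/(Hp s (oapp e x)).
Qed.

Lemma def_cond V (b : bool) (P : forall s, (V -> M s) -> Prop) :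
  (b -> definable P) -> definable (fun s e => b -> P s e).
Proof.
case: b => [/(_ isT) dP|_]; first by apply: def_ext dP => s e; split=> [H _|]; last exact.
by exists (Imp Bot Bot) => s e /=; split.
Qed.

Lemma def_forall_fin V (I : finType) (P : I -> forall s, (V -> M s) -> Prop) :
  (forall i, definable (P i)) -> definable (fun s e => forall i, P i s e).
Proof.
move=> dP.
suff [p Hp] : definable (fun s e => forall i, i \in enum I -> P i s e).
  by exists p => s e; rewrite Hp; split=> [H i|H i _]; apply: H; rewrite mem_enum.
elim: (enum I) => [|i r IH]; first by exists (Imp Bot Bot) => s e /=; split.
apply: def_ext (def_and (dP i) IH) => s e; split.
  by move=> [Hi Hr] j; rewrite inE => /orP[/eqP->|/Hr].
by move=> H; split=> [|j jr]; apply: H; rewrite inE ?eqxx ?jr ?orbT.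
Qed.

End Definability.

(* Quantification over a finite family reduces to repeated quantification over
   one element; this only uses closure under renaming and single quantifiers,
   so it also serves for definability through an interpretation. *)
Section FiniteBlocks.
Variables (S : Type) (M : S -> Type).
Variable D : forall V, (forall s, (V -> M s) -> Prop) -> Prop.
Hypothesis D_rename : forall V W (r : V -> W) (P : forall s, (V -> M s) -> Prop),
  D P -> D (fun s (e : W -> M s) => P s (e \o r)).
Variable Q : forall T : Type, (T -> Prop) -> Prop.
Hypothesis Q_ext : forall T (P P' : T -> Prop), (forall x, P x <-> P' x) ->
  (Q P <-> Q P').
Hypothesis Q_one : forall T (x : T) (P : T -> Prop), (forall y, y = x) ->
  (P x <-> Q P).
Hypothesis Q_pair : forall T T' U (f : T -> T' -> U) (P : U -> Prop),
  (forall u, exists x y, u = f x y) ->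
  Q P <-> Q (fun x => Q (fun y => P (f x y))).
Hypothesis D_one : forall V (P : forall s, (V -> M s) -> M s -> Prop),
  D (fun s (e : option V -> M s) => P s (e \o Some) (e None)) ->
  D (fun s e => Q (P s e)).
Hypothesis D_ext : forall V (P P' : forall s, (V -> M s) -> Prop),
  (forall s e, P s e <-> P' s e) -> D P -> D P'.

Lemma block_fin V (J : finType) (P : forall s, (V -> M s) -> (J -> M s) -> Prop) :
  D (fun s (e : V + J -> M s) => P s (e \o inl) (e \o inr)) ->
  D (fun s e => Q (P s e)).
Proof.
suff block_ord m : forall V (P : forall s, (V -> M s) -> ('I_m -> M s) -> Prop),
    D (fun s (e : V + 'I_m -> M s) => P s (e \o inl) (e \o inr)) ->
    D (fun s e => Q (P s e)).
  move=> DP.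
  have := block_ord #|J| V (fun s e t => P s e (t \o enum_rank)) _.
  set H := (X in (X -> _) -> _) => HH; have /HH : H.
    pose r (x : V + J) : V + 'I_#|J| :=
      match x with inl v => inl v | inr j => inr (enum_rank j) end.
    exact: (@D_rename _ _ r _ DP).
  apply: D_ext => s e.
  rewrite (@Q_pair unit _ _ (fun _ (t : 'I_#|J| -> M s) => t \o enum_rank) (P s e)).
    by apply: Q_one; case.
  move=> t; exists tt, (t \o enum_val).
  by apply: functional_extensionality => j /=; rewrite enum_rankK.
elim: m => [|m IH] {}V {}P DP.
  pose r (x : V + 'I_0) : V :=
    match x with inl v => v | inr j => False_rect V (notF (ltn_ord j)) end.
  apply: D_ext (@D_rename _ _ r _ DP) => s e.
  have E (a b : 'I_0 -> M s) : a = b by apply: functional_extensionality; case.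
  rewrite -(Q_one _ (fun y => E y ((e \o r) \o inr))).
  by [].
pose r (x : V + 'I_m.+1) : option V + 'I_m :=
  match x with
  | inl v => inl (Some v)
  | inr j => oapp inr (inl None) (unlift ord0 j)
  end.
pose cons (T : Type) x (t : 'I_m -> T) (j : 'I_m.+1) := oapp t x (unlift ord0 j).
have := IH (option V) (fun s e t => P s (e \o Some) (cons _ (e None) t)) _.
set H := (X in (X -> _) -> _) => HH; have {HH} /HH : H.
  apply: D_ext (@D_rename _ _ r _ DP) => s e.
  have -> // : (e \o r) \o inr = cons _ (e (inl None)) (e \o inr).
  by apply: functional_extensionality => j; rewrite /cons /=; case: unlift.
move/(@D_one V (fun s e x => Q (fun t => P s e (cons _ x t)))).
apply: D_ext => s e; symmetry; apply: Q_pair => t.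
exists (t ord0), (t \o lift ord0); apply: functional_extensionality => j.
by rewrite /cons; case: unliftP => [i ->|->].
Qed.

End FiniteBlocks.

Lemma forall_block_pair T T' U (f : T -> T' -> U) (P : U -> Prop) :
  (forall u, exists x y, u = f x y) ->
  (forall u, P u) <-> (forall x y, P (f x y)).
Proof. by move=> f_surj; split=> [//|H u]; have [x [y ->]] := f_surj u. Qed.

Lemma exists_block_pair T T' U (f : T -> T' -> U) (P : U -> Prop) :
  (forall u, exists x y, u = f x y) ->
  (exists u, P u) <-> (exists x y, P (f x y)).
Proof.
move=> f_surj; split=> [[u Pu]|[x [y Pxy]]]; last by exists (f x y).
by have [x [y def_u]] := f_surj u; exists x, y; rewrite -def_u.
Qed.

Section DefinableBlocks.
Variables (S : Type) (M : S -> Type).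
Variable D : forall V, (forall s, (V -> M s) -> Prop) -> Prop.
Hypothesis D_rename : forall V W (r : V -> W) (P : forall s, (V -> M s) -> Prop),
  D P -> D (fun s (e : W -> M s) => P s (e \o r)).
Hypothesis D_ext : forall V (P P' : forall s, (V -> M s) -> Prop),
  (forall s e, P s e <-> P' s e) -> D P -> D P'.

Lemma all_block (D_all : forall V (P : forall s, (V -> M s) -> M s -> Prop),
    D (fun s (e : option V -> M s) => P s (e \o Some) (e None)) ->
    D (fun s e => forall x, P s e x))
  V (J : finType) (P : forall s, (V -> M s) -> (J -> M s) -> Prop) :
  D (fun s (e : V + J -> M s) => P s (e \o inl) (e \o inr)) ->
  D (fun s e => forall t, P s e t).
Proof.
apply: (@block_fin _ _ _ D_rename (fun T P => forall x, P x)) => //.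
- by move=> T x P1 Hx; split=> H // y; rewrite (Hx y).
- exact: forall_block_pair.
Qed.

Lemma ex_block (D_ex : forall V (P : forall s, (V -> M s) -> M s -> Prop),
    D (fun s (e : option V -> M s) => P s (e \o Some) (e None)) ->
    D (fun s e => exists x, P s e x))
  V (J : finType) (P : forall s, (V -> M s) -> (J -> M s) -> Prop) :
  D (fun s (e : V + J -> M s) => P s (e \o inl) (e \o inr)) ->
  D (fun s e => exists t, P s e t).
Proof.
apply: (@block_fin _ _ _ D_rename (fun T P => exists x, P x)) => //.
- by move=> T x P1 Hx; split=> [H|[y]]; [exists x|rewrite (Hx y)].
- exact: exists_block_pair.
Qed.

End DefinableBlocks.

Section DefinableFinite.
Variables (A : language) (S : Type) (M : S -> structure A).
Variables (V : Type) (J : finType) (P : forall s, (V -> M s) -> (J -> M s) -> Prop).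
Hypothesis dP : definable (fun s (e : V + J -> M s) => P (e \o inl) (e \o inr)).

Lemma def_all_fin : definable (fun s e => forall t, @P s e t).
Proof.
exact: (all_block (@def_rename _ _ M) (@def_ext _ _ M) (@def_all _ _ M) dP).
Qed.

Lemma def_ex_fin : definable (fun s e => exists t, @P s e t).
Proof.
exact: (ex_block (@def_rename _ _ M) (@def_ext _ _ M) (@def_ex _ _ M) dP).
Qed.

End DefinableFinite.

(** * Interpretations *)

Section Interpretation.
Variables (A B : language) (S : Type) (N : S -> structure A) (M : S -> structure B).
Variables (I : finType) (W : Type).
Variables (c : forall s, N s -> I -> M s) (p : forall s, W -> M s).

Definition code_val s V (e : V -> N s) : W + V * I -> M s :=
  join (@p s) (fun x => c (e x.1) x.2).

(** Definability in [M s] of a predicate on [N s], through the coding. *)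
Definition idefinable V (P : forall s, (V -> N s) -> Prop) :=
  exists phi : formula B (W + V * I),
    forall s (e : V -> N s), holds (code_val e) phi <-> P s e.

Variable delta : formula B (W + I).
Hypothesis delta_dom : forall s (m : I -> M s),
  holds (join (@p s) m) delta <-> exists x, c x = m.
Hypothesis c_inj : forall s, injective (@c s).
Hypothesis c_op : forall f : A,
  idefinable (fun s (e : option 'I_(arity f) -> N s) => e None = interp (e \o Some)).

Lemma idef_ext V (P Q : forall s, (V -> N s) -> Prop) :
  (forall s e, P s e <-> Q s e) -> idefinable P -> idefinable Q.
Proof. by move=> PQ [phi Hphi]; exists phi => s e; rewrite Hphi. Qed.

Lemma idef_of_def V (P : forall s, (V -> N s) -> Prop)
  (P' : forall s, (W + V * I -> M s) -> Prop) :
  definable P' -> (forall s e, P' s (code_val e) <-> P s e) -> idefinable P.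
Proof. by move=> [phi Hphi] PP'; exists phi => s e; rewrite Hphi. Qed.

Lemma idef_rename V V' (r : V -> V') (P : forall s, (V -> N s) -> Prop) :
  idefinable P -> idefinable (fun s (e : V' -> N s) => P s (e \o r)).
Proof.
move=> [phi Hphi].
pose r' (x : W + V * I) : W + V' * I :=
  match x with inl w => inl w | inr vi => inr (r vi.1, vi.2) end.
exists (frename r' phi) => s e; rewrite holds_rename -Hphi.
by have -> // : code_val e \o r' = code_val (e \o r)
  by apply: functional_extensionality; case.
Qed.

Lemma idef_var_eq V (v w : V) : idefinable (fun s (e : V -> N s) => e v = e w).
Proof.
apply: (@idef_of_def _ _ (fun s e' => forall i, e' (inr (v, i)) = e' (inr (w, i)))).
  by apply: def_forall_fin => i; apply: def_eq; apply: tdef_var.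
move=> s e /=; split=> [ce|-> //]; apply: c_inj.
exact: functional_extensionality.
Qed.

Section OneVariable.
Variables (V : Type) (P : forall s, (V -> N s) -> N s -> Prop).
Hypothesis dP : idefinable (fun s (e : option V -> N s) => P (e \o Some) (e None)).

Let r1 (x : W + I) : (W + V * I) + I :=
  match x with inl w => inl (inl w) | inr i => inr i end.
Let r2 (x : W + option V * I) : (W + V * I) + I :=
  match x with
  | inl w => inl (inl w)
  | inr (Some v, i) => inl (inr (v, i))
  | inr (None, i) => inr i
  end.

Let r1E s (e : V -> N s) (m : I -> M s) :
  join (code_val e) m \o r1 = join (@p s) m.
Proof. by apply: functional_extensionality; case. Qed.

Let r2E s (e : V -> N s) (x : N s) :
  join (code_val e) (c x) \o r2 = code_val (oapp e x).
Proof. by apply: functional_extensionality => -[w|[[v|] i]]. Qed.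

Lemma idef_all : idefinable (fun s e => forall x, @P s e x).
Proof.
have [phi Hphi] := dP.
apply: (@idef_of_def _ _ (fun s e' => forall m : I -> M s,
  holds (join e' m \o r1) delta -> holds (join e' m \o r2) phi)).
  apply: def_all_fin; apply: def_ext (_ : definable (fun s (e : _ -> M s) =>
    holds (e \o r1) delta -> holds (e \o r2) phi)).
    move=> s e; suff -> : join (e \o inl) (e \o inr) = e by [].
    by apply: functional_extensionality; case.
  by apply: def_imp; apply: def_holds_rename.
move=> s e; split=> [H x|H m].
  have := H (c x); rewrite r1E r2E Hphi => H'; apply: H'.
  by apply/delta_dom; exists x.
by rewrite r1E => /delta_dom[x <-]; rewrite r2E Hphi.
Qed.

Lemma idef_ex : idefinable (fun s e => exists x, @P s e x).
Proof.
have [phi Hphi] := dP.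
apply: (@idef_of_def _ _ (fun s e' => exists m : I -> M s,
  holds (join e' m \o r1) delta /\ holds (join e' m \o r2) phi)).
  apply: def_ex_fin; apply: def_ext (_ : definable (fun s (e : _ -> M s) =>
    holds (e \o r1) delta /\ holds (e \o r2) phi)).
    move=> s e; suff -> : join (e \o inl) (e \o inr) = e by [].
    by apply: functional_extensionality; case.
  by apply: def_and; apply: def_holds_rename.
move=> s e; split=> [[m []]|[x Px]].
  rewrite r1E => /delta_dom[x <-]; rewrite r2E Hphi => Px.
  by exists x.
exists (c x); rewrite r1E r2E Hphi; split=> //.
by apply/delta_dom; exists x.
Qed.

End OneVariable.

Lemma idef_and V (P Q : forall s, (V -> N s) -> Prop) :
  idefinable P -> idefinable Q -> idefinable (fun s e => P s e /\ Q s e).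
Proof. by case=> f Hf [g Hg]; exists (And f g) => s e /=; rewrite Hf Hg. Qed.

Lemma idef_forall_fin V (J : finType) (P : J -> forall s, (V -> N s) -> Prop) :
  (forall j, idefinable (P j)) -> idefinable (fun s e => forall j, P j s e).
Proof.
move=> /fin_all_exists[phi Hphi].
apply: (@idef_of_def _ _ (fun s e => forall j, holds e (phi j))).
  by apply: def_forall_fin => j; apply: def_holds.
move=> s e; split=> H j; apply/(Hphi j); apply: H.
Qed.

(** Terms are unnested: the values of the arguments are quantified, so that only
   the graphs of the operations have to be translated. *)
Lemma idef_term V (t : term A V) :
  idefinable (fun s (e : option V -> N s) => e None = eval (e \o Some) t).
Proof.
elim: t => [v|f args IH] /=; first exact: idef_var_eq.
apply: (@idef_ext _ (fun s e => exists y : 'I_(arity f) -> N s,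
    (forall k, y k = eval (e \o Some) (args k)) /\ e None = interp y)).
  move=> s e; split=> [[y [Hy ->]]|->].
    by congr interp; apply: functional_extensionality.
  by exists (fun k => eval (e \o Some) (args k)).
apply: (ex_block idef_rename idef_ext idef_ex).
apply: idef_and.
  apply: idef_forall_fin => k.
  pose r (x : option V) : option V + 'I_(arity f) :=
    if x is Some v then inl (Some v) else inr k.
  exact: (idef_rename r (IH k)).
pose r (x : option 'I_(arity f)) : option V + 'I_(arity f) :=
  if x is Some k then inr k else inl None.
exact: (idef_rename r (c_op f)).
Qed.

(** A quantifier over [N s] becomes a block of quantifiers over the coordinates
   in [M s], relativized to the tuples in [delta] that code an element. *)
Theorem interpretation V (phi : formula A V) :
  exists psi : formula B (W + V * I),
    forall s (e : V -> N s), holds (code_val e) psi <-> holds e phi.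
Proof.
have oappE U s (e : option U -> N s) : oapp (e \o Some) (e None) = e.
  by apply: functional_extensionality; case.
rewrite -/(idefinable (fun s e => holds e phi)).
elim: phi => {V} [V|V t u|V q IHq r IHr|V q [f Hf] r [g Hg]|V q [f Hf] r [g Hg]
  |V q IHq|V q IHq].
- by exists Bot.
- apply: idef_ext (_ : idefinable (fun s e =>
    exists x, x = eval e t /\ x = eval e u)) => [s e /=|].
    by split=> [[x [<- <-]]|<-] //; exists (eval e t).
  by apply: idef_ex; apply: idef_and; apply: idef_term.
- exact: idef_and.
- by exists (Or f g) => s e /=; rewrite Hf Hg.
- by exists (Imp f g) => s e /=; rewrite Hf Hg.
- apply: (@idef_all _ (fun s e x => holds (oapp e x) q)).
  by apply: idef_ext IHq => s e; rewrite oappE.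
- apply: (@idef_ex _ (fun s e x => holds (oapp e x) q)).
  by apply: idef_ext IHq => s e; rewrite oappE.
Qed.

End Interpretation.

(** * Isomorphisms and elementary equivalence *)

Section Isomorphism.
Variables (A : language) (M N : structure A) (h : M -> N) (k : N -> M).
Hypotheses (hK : cancel h k) (kK : cancel k h).
Hypothesis h_op : forall (f : A) (a : 'I_(arity f) -> M),
  h (interp a) = interp (h \o a).

Lemma iso_eval V (e : V -> M) (t : term A V) : h (eval e t) = eval (h \o e) t.
Proof.
elim: t => [v|f args IH] //=; rewrite h_op; congr interp.
exact: functional_extensionality.
Qed.

Lemma iso_holds V (phi : formula A V) (e : V -> M) :
  holds e phi <-> holds (h \o e) phi.
Proof.
have oappE U (e' : U -> M) x : h \o oapp e' x = oapp (h \o e') (h x).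
  by apply: functional_extensionality; case.
elim: phi e => {V} [V|V t u|V p IHp q IHq|V p IHp q IHq|V p IHp q IHq
  |V p IHp|V p IHp] e //=.
- by rewrite -!iso_eval; split=> [->//|/(can_inj hK)].
- by rewrite IHp IHq.
- by rewrite IHp IHq.
- by rewrite IHp IHq.
- split=> H x; last by rewrite IHp oappE.
  by have := H (k x); rewrite IHp oappE kK.
- split=> -[x]; first by rewrite IHp oappE; exists (h x).
  by exists (k x); rewrite IHp oappE kK.
Qed.

Lemma iso_elem_equiv : elem_equiv M N.
Proof.
move=> phi; rewrite /satisfies iso_holds.
by have -> // : h \o of_void M = of_void N by apply: functional_extensionality; case.
Qed.

End Isomorphism.

Lemma group_isomorphic_elem_equiv (G H : groupType) : group_isomorphic G H ->
  elem_equiv (group_structure G) (group_structure H).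
Proof.
move=> [f [g fK gK]].
apply: (@iso_elem_equiv group_language (group_structure G) (group_structure H) f g fK gK).
have f1 : f 1%g = 1%g by apply: (mulgI (f 1%g)); rewrite -gmulfM !mulg1.
case=> a /=; [exact: f1| |exact: gmulfM].
by apply: (mulgI (f (a ord0))); rewrite -gmulfM !mulgV f1.
Qed.

(** * Matrix entries interpret SL in the field *)

Section RingTerms.
Notation rdef := (@tdefinable ring_language fieldType (fun F => ring_structure F) _).
Variable V : Type.
Implicit Types f g : forall F : fieldType, (V -> F) -> F.

Lemma rdef_0 : rdef (fun F (_ : V -> F) => 0 : F).
Proof. by exists (@App ring_language V RZero (fun i => False_rect _ (notF (ltn_ord i)))). Qed.

Lemma rdef_1 : rdef (fun F (_ : V -> F) => 1 : F).
Proof. by exists (@App ring_language V ROne (fun i => False_rect _ (notF (ltn_ord i)))). Qed.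

Lemma rdef_opp f : rdef f -> rdef (fun F e => - f F e).
Proof.
by move=> [t Ht]; exists (@App ring_language V ROpp (fun=> t)) => F e /=; rewrite Ht.
Qed.

Lemma rdef_add f g : rdef f -> rdef g -> rdef (fun F e => f F e + g F e).
Proof.
move=> [t Ht] [u Hu].
exists (@App ring_language V RAdd (fun i : 'I_2 => if i == ord0 then t else u)) => F e /=.
by rewrite Ht Hu.
Qed.

Lemma rdef_mul f g : rdef f -> rdef g -> rdef (fun F e => f F e * g F e).
Proof.
move=> [t Ht] [u Hu].
exists (@App ring_language V RMul (fun i : 'I_2 => if i == ord0 then t else u)) => F e /=.
by rewrite Ht Hu.
Qed.

Lemma rdef_sum (I : Type) (r : seq I) (f : I -> forall F : fieldType, (V -> F) -> F) :
  (forall i, rdef (f i)) -> rdef (fun F e => \sum_(i <- r) f i F e).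
Proof.
move=> df; elim: r => [|i r IH].
  by apply: tdef_ext rdef_0 => F e; rewrite big_nil.
by apply: tdef_ext (rdef_add (df i) IH) => F e; rewrite big_cons.
Qed.

Lemma rdef_prod (I : Type) (r : seq I) (f : I -> forall F : fieldType, (V -> F) -> F) :
  (forall i, rdef (f i)) -> rdef (fun F e => \prod_(i <- r) f i F e).
Proof.
move=> df; elim: r => [|i r IH].
  by apply: tdef_ext rdef_1 => F e; rewrite big_nil.
by apply: tdef_ext (rdef_mul (df i) IH) => F e; rewrite big_cons.
Qed.

Lemma rdef_bool (b : bool) : rdef (fun F (_ : V -> F) => b%:R : F).
Proof. by case: b; [exact: rdef_1|exact: rdef_0]. Qed.

Lemma rdef_mulmx n m k (f : forall F : fieldType, (V -> F) -> 'M[F]_(m, n))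
    (g : forall F : fieldType, (V -> F) -> 'M[F]_(n, k)) :
  (forall i j, rdef (fun F e => f F e i j)) ->
  (forall i j, rdef (fun F e => g F e i j)) ->
  forall i j, rdef (fun F e => (f F e *m g F e) i j).
Proof.
move=> df dg i j.
apply: tdef_ext (@rdef_sum _ (index_enum 'I_n) (fun l F e => f F e i l * g F e l j) _).
  by move=> F e; rewrite mxE.
by move=> l; apply: rdef_mul.
Qed.

Lemma rdef_det n (f : forall F : fieldType, (V -> F) -> 'M[F]_n) :
  (forall i j, rdef (fun F e => f F e i j)) -> rdef (fun F e => \det (f F e)).
Proof.
move=> df; apply: rdef_sum => s; apply: rdef_mul; last exact: rdef_prod.
by case: (perm.odd_perm s); [exact/rdef_opp/rdef_1|exact: rdef_1].
Qed.

End RingTerms.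

Section SLInterpretation.
Variable n : nat.

Definition SLcode (F : fieldType) (A : SL n F) (ij : 'I_n * 'I_n) : F := A ij.1 ij.2.

Lemma SLcode_inj F : injective (@SLcode F).
Proof. by move=> A B AB; apply/val_inj/matrixP=> i j; apply: (congr1 (fun f => f (i, j)) AB). Qed.

Notation SLdef := (@idefinable group_language ring_language fieldType
  (fun F => group_structure (SL n F)) (fun F => ring_structure F)
  ('I_n * 'I_n)%type void SLcode (fun F => of_void F) _).

(** Inversion needs no cofactors: its graph is the equation [B *m A = 1]. *)
Lemma SL_interpretation V (phi : formula group_language V) :
  exists psi : formula ring_language (void + V * ('I_n * 'I_n)),
    forall (F : fieldType) (e : V -> SL n F),
      @holds _ (ring_structure F) _ (join (of_void F) (fun x => SLcode (e x.1) x.2)) psi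
      <-> @holds _ (group_structure (SL n F)) _ e phi.
Proof.
have dvar U (u : U) i j : tdefinable (M := fun F : fieldType => ring_structure F)
    (fun F (e : void + U * ('I_n * 'I_n) -> F) => e (inr (u, (i, j)))).
  exact: tdef_var.
pose mx U (u : U) F (e : void + U * ('I_n * 'I_n) -> F) : 'M[F]_n :=
  \matrix_(i, j) e (inr (u, (i, j))).
have dmx U (u : U) i j : tdefinable (M := fun F : fieldType => ring_structure F)
    (fun F (e : void + U * ('I_n * 'I_n) -> F) => mx U u F e i j).
  by apply: tdef_ext (dvar U u i j) => F e; rewrite mxE.
have [delta Hdelta] : definable (M := fun F : fieldType => ring_structure F)
    (fun F (e : void + ('I_n * 'I_n) -> F) =>
      \det (\matrix_(i, j) e (inr (i, j)) : 'M[F]_n) = 1).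
  apply: def_eq; last exact: rdef_1.
  apply: rdef_det => i j.
  by apply: tdef_ext (tdef_var _ (inr (i, j))) => F e; rewrite mxE.
have mxE' U (u : U) F (e : U -> SL n F) :
    mx U u F (join (of_void F) (fun x => SLcode (e x.1) x.2)) = e u.
  by apply/matrixP=> i j; rewrite mxE.
have dentries U (f g : forall F : fieldType, (void + U * ('I_n * 'I_n) -> F) -> 'M[F]_n)
    (P : forall F : fieldType, (U -> SL n F) -> Prop) :
    (forall i j, tdefinable (M := fun F : fieldType => ring_structure F)
      (fun F e => f F e i j)) ->
    (forall i j, tdefinable (M := fun F : fieldType => ring_structure F)
      (fun F e => g F e i j)) ->
    (forall (F : fieldType) (e : U -> SL n F),
      let e' := join (of_void F) (fun x => SLcode (e x.1) x.2) in
      f F e' = g F e' <-> P F e) ->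
    SLdef P.
  move=> df dg fgP.
  have [phi' Hphi'] : definable (M := fun F : fieldType => ring_structure F)
      (fun F e => forall i j, f F e i j = g F e i j).
    by apply: def_forall_fin => i; apply: def_forall_fin => j; apply: def_eq.
  exists phi' => F e; rewrite -fgP Hphi'.
  by split=> [H|H i j]; [apply/matrixP|rewrite [f F _]H].
apply: (@interpretation group_language ring_language fieldType
  (fun F => group_structure (SL n F)) (fun F => ring_structure F)
  ('I_n * 'I_n)%type void SLcode (fun F => of_void F) delta) => [F m|F|f].
- rewrite Hdelta; split=> [/eqP Hm|[A <-]].
    by exists (MkSL Hm); apply: functional_extensionality => -[i j]; rewrite /SLcode /= mxE.
  by rewrite -[RHS](det_SL A); congr (\det _); apply/matrixP => i j; rewrite mxE.
- exact: SLcode_inj.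
- case: f.
  + apply: (dentries _ (mx _ None) (fun F _ => 1%:M)) => [||F e /=].
    * exact: dmx.
    * move=> i j; apply: tdef_ext (rdef_bool _ (i == j)) => F e; by rewrite mxE.
    * by rewrite mxE'; split=> [H|-> //]; apply: val_inj.
  + apply: (dentries _ (fun F e => mx _ None F e *m mx _ (Some ord0) F e) (fun F _ => 1%:M))
      => [||F e /=].
    * by apply: rdef_mulmx; apply: dmx.
    * move=> i j; apply: tdef_ext (rdef_bool _ (i == j)) => F e; by rewrite mxE.
    * rewrite !mxE'; split=> [H|->]; last by rewrite mulVmx ?SL_unitmx.
      by apply: (mulIg (e (Some ord0))); rewrite mulVg; apply: val_inj.
  + apply: (dentries _ (mx _ None) (fun F e => mx _ (Some ord0) F e *m mx _ (Some ord_max) F e))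
      => [||F e /=].
    * exact: dmx.
    * by apply: rdef_mulmx; apply: dmx.
    * by rewrite !mxE'; split=> [H|-> //]; apply: val_inj.
Qed.

Lemma SL_elem_equiv (F L : fieldType) : elem_equiv (ring_structure F) (ring_structure L) ->
  elem_equiv (group_structure (SL n F)) (group_structure (SL n L)).
Proof.
move=> FL phi; have [psi Hpsi] := SL_interpretation phi.
pose r (x : void + void * ('I_n * 'I_n)) : void := match x with inl v => v | inr v => v.1 end.
suff H (K : fieldType) : satisfies (group_structure (SL n K)) phi <->
    satisfies (ring_structure K) (frename r psi).
  by rewrite !H.
rewrite /satisfies -Hpsi holds_rename.
set e1 := join _ _; set e2 := _ \o r.
by have -> // : e1 = e2 by apply: functional_extensionality => -[|[]] [].
Qed.

End SLInterpretation.

(** * Unipotence from traces *)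

Section Unipotence.
Variable F : fieldType.

(** A rank factorization [e = C *m R] of an idempotent satisfies [R *m C = 1]. *)
Lemma mxtrace_idempotent n (e : 'M[F]_n) : e *m e = e -> \tr e = (\rank e)%:R.
Proof.
move=> ee.
have RC : row_base e *m col_base e = 1%:M.
  apply: (row_full_inj (col_base_full e)).
  apply: (row_free_inj (row_base_free e)) => /=.
  have e_base : forall r (C : 'M_(n, r)) R, C *m R = e -> C *m (R *m C) *m R = C *m 1%:M *m R.
    by move=> r C R CR; rewrite mulmx1 !mulmxA CR -mulmxA CR.
  exact: e_base (mulmx_base e).
by rewrite -{1}(mulmx_base e) mxtrace_mulC RC mxtrace1.
Qed.

Lemma mxtrace_horner n (x : 'M[F]_n.+1) (r : {poly F}) :
  \tr (horner_mx x r) = \sum_(i < size r) r`_i * \tr (x ^+ i).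
Proof.
rewrite -{1}(coefK r) poly_def rmorph_sum raddf_sum; apply: eq_bigr => i _ /=.
by rewrite horner_mxZ mxtraceZ rmorphXn /= horner_mx_X.
Qed.

(** The projection that kills the generalized eigenspace of [1], along the other
   generalized eigenspaces, is a polynomial [r] in [x].  As [x] is invertible,
   [r] can be chosen divisible by ['X * ('X - 1)] and of degree at most [n.+2].
   Then [r] has no constant term, so the trace of the projection is
   [r.[1] * tau = 0], and in characteristic zero an idempotent of trace [0]
   vanishes. *)
Lemma unipotent_of_power_traces n (x : 'M[F]_n.+1) (tau : F) :
  [pchar F] =i pred0 -> x \in unitmx ->
  (forall j, (0 < j <= n.+2)%N -> \tr (x ^+ j) = tau) ->
  exists k, (x - 1) ^+ k = 0.
Proof.
move=> charF0 x_unit tr_x; pose chi := char_poly x.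
have chi_x : horner_mx x chi = 0 by apply: Cayley_Hamilton.
have chi_neq0 : chi != 0 by rewrite -size_poly_eq0 size_char_poly.
have [k [g]] := multiplicity_XsubC chi 1; rewrite chi_neq0 /= => g1 def_chi.
have g0 : ~~ root g 0.
  apply/negP => /rootP g0.
  have : chi.[0] != 0.
    rewrite horner_coef0 char_poly_det mulf_neq0 ?signr_eq0 //.
    by move: x_unit; rewrite unitmxE unitfE.
  by rewrite def_chi hornerM g0 mul0r eqxx.
pose d : {poly F} := 'X * ('X - 1%:P).
have cop : coprimep (d * ('X - 1%:P) ^+ k) g.
  rewrite coprimep_sym !coprimepMr coprimepX g0 coprimep_XsubC g1 /=.
  by rewrite coprimep_expr // coprimep_XsubC.
have /Bezout_eq1_coprimepP[[u v] /= uv1] := cop.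
(* [e] is the projection, and reducing [q] modulo [d * chi] bounds the degree
   without losing divisibility by [d]. *)
pose q := u * (d * ('X - 1%:P) ^+ k); pose e := horner_mx x q.
have vg_x : horner_mx x (v * g) = 1 - e.
  by apply/eqP; rewrite eq_sym subr_eq addrC -rmorphD /= uv1 rmorph1.
have ee : e *m e = e.
  suff /eqP : e * (1 - e) = 0 by rewrite mulrBr mulr1 subr_eq0 => /eqP/esym.
  rewrite -vg_x -rmorphM /=.
  have -> : q * (v * g) = (u * d * v) * chi.
    by rewrite def_chi /q; ring.
  by rewrite rmorphM /= chi_x mulr0.
pose r := q %% (d * chi).
have d_neq0 : d != 0 by rewrite mulf_neq0 ?polyX_eq0 ?polyXsubC_eq0.
have e_r : e = horner_mx x r.
  rewrite /e [q in LHS](divp_eq q (d * chi)) rmorphD /= !rmorphM /= chi_x.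
  by rewrite !mulr0 add0r.
have d_r : d %| r.
  rewrite -dvdp_mod ?dvdp_mulIl //.
  by rewrite /q dvdp_mull // dvdp_mulr.
have [r0 r1] : r.[0] = 0 /\ r.[1] = 0.
  have [w ->] := dvdpP _ _ d_r.
  by rewrite !hornerM !hornerXsubC !hornerX subrr !(mulr0, mul0r).
have size_r : (size r <= n.+3)%N.
  have := ltn_modpN0 q (mulf_neq0 d_neq0 chi_neq0).
  rewrite -/r size_mul // size_char_poly /d size_mul ?polyX_eq0 ?polyXsubC_eq0 //.
  by rewrite size_polyX size_XsubC /= ltnS.
have tr_e : \tr e = 0.
  rewrite e_r mxtrace_horner.
  transitivity (\sum_(i < size r) r`_i * tau).
    apply: eq_bigr => -[[|i] i_r] _ /=; first by rewrite -horner_coef0 r0 !mul0r.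
    by rewrite tr_x //= -ltnS (leq_trans i_r).
  rewrite -mulr_suml; have := r1; rewrite horner_coef => r1'.
  by rewrite (_ : \sum_i _ = 0) ?mul0r // -[RHS]r1'; apply: eq_bigr => i _; rewrite expr1n mulr1.
have e0 : e = 0.
  move: tr_e; rewrite mxtrace_idempotent // => /eqP.
  by move/pcharf0P: charF0 => ->; rewrite mxrank_eq0 => /eqP.
exists k; rewrite e0 subr0 in vg_x.
have -> : x - 1 = horner_mx x ('X - 1%:P) by rewrite rmorphB /= horner_mx_X horner_mx_C.
rewrite -rmorphXn -[LHS]mulr1 -vg_x -rmorphM /= mulrC -mulrA -def_chi.
by rewrite rmorphM /= chi_x mulr0.
Qed.

End Unipotence.

(** * Unipotent matrices with unitriangular commutator relations *)

Section RankOne.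
Variable F : fieldType.

Lemma rank1_factor m n (A : 'M[F]_(m, n)) : \rank A = 1%N ->
  exists (u : 'cV[F]_m) (v : 'rV[F]_n), A = u *m v.
Proof.
move=> rA; have := mulmx_base A; move: (col_base A) (row_base A).
by rewrite rA => u v <-; exists u, v.
Qed.

(** Both matrices factor through the quotient by [V], of dimension at most one,
   and have their image in the line [W]. *)
Lemma rank1_proportional n (A B W V : 'M[F]_n.+1) : A != 0 ->
  (A <= W)%MS -> (B <= W)%MS -> (\rank W <= 1)%N ->
  V *m A = 0 -> V *m B = 0 -> (n <= \rank V)%N ->
  exists a, B = a *: A.
Proof.
move=> A0 AW BW rW VA VB rV.
have rA : \rank A = 1%N.
  apply/eqP; rewrite eqn_leq lt0n mxrank_eq0 A0 andbT.
  exact: leq_trans (mxrankS AW) rW.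
have BA : (B <= A)%MS.
  apply: submx_trans BW _.
  by have [_ /esym] := mxrank_leqif_sup AW; rewrite eqn_leq rA rW lt0n mxrank_eq0;
    case: eqVneq => // W0; move: AW; rewrite W0 submx0 (negPf A0).
have BtAt : (B^T <= A^T)%MS.
  have kerV (C : 'M_n.+1) : V *m C = 0 -> (C^T <= kermx V^T)%MS.
    by move=> VC; apply/sub_kermxP; rewrite -trmx_mul VC trmx0.
  apply: submx_trans (kerV _ VB) _.
  have [_ /esym] := mxrank_leqif_sup (kerV _ VA).
  rewrite eqn_leq {1}(mxrankS (kerV _ VA)) mxrank_ker !mxrank_tr rA => -> //.
  by move: rV; lia.
have [u [v def_A]] := rank1_factor rA.
have /submxP[D defB] := BA; have /submxP[E defBt] := BtAt.
have {defBt} defB' : B = u *m (v *m E^T).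
  by rewrite mulmxA -def_A -[B]trmxK defBt trmx_mul trmxK.
have v0 : v != 0 by apply: contraNneq A0 => v0; rewrite def_A v0 mulmx0.
have /rV0Pn[j vj] := v0.
exists ((v *m E^T) 0 j / v 0 j).
have Duj : D *m u = ((v *m E^T) 0 j / v 0 j) *: u.
  apply/colP => i.
  have : B i j = (D *m u) i 0 * v 0 j by rewrite defB def_A mulmxA mxE big_ord1.
  rewrite defB' mxE big_ord1 => H.
  by rewrite [RHS]mxE; apply: (mulIf vj); rewrite -[LHS]H mulrAC divfK // mulrC.
by rewrite defB def_A mulmxA Duj -scalemxAl.
Qed.

End RankOne.

Section Unitriangular.
Variables (F : fieldType) (n : nat) (T : finType).
Variables (y : T -> 'M[F]_n.+1) (h : T -> nat) (S : {set T}).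
Hypothesis y_unip : forall a, a \in S -> exists k, (y a - 1%:M) ^+ k = 0.
Hypothesis y_unit : forall a, a \in S -> y a \in unitmx.
Hypothesis y_comm : forall a b, a \in S -> b \in S ->
  y a *m y b = y b *m y a \/
  exists c, [/\ c \in S, (h a < h c)%N &
    y a *m y b = y c *m y b *m y a \/ y b *m y a = y c *m y a *m y b].

Definition stable (V : 'M[F]_n.+1) := forall a, a \in S -> (V *m y a <= V)%MS.

(** The row space spanned by the images of [V] under the [y a - 1]. *)
Definition augment (B : {set T}) (V : 'M[F]_n.+1) := (\sum_(a in B) V *m (y a - 1%:M))%MS.

(** Kolchin's argument.  Take the matrices by decreasing height.  Modulo the
   images collected so far the next [y a] commutes with every [y b], so its image
   is stable, and [y a - 1] is nilpotent, so adding this image to a proper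
   subspace cannot give the whole of [V]. *)
Lemma augment_proper V (B : {set T}) : V != 0 -> stable V -> B \subset S ->
  (forall a c, a \in B -> c \in S -> (h a < h c)%N -> c \in B) ->
  stable (augment B V) /\ ~~ (V <= augment B V)%MS.
Proof.
move=> V0 Vst; have [m] := ubnP #|B|; elim: m B => // m IH B cardB BS Bup.
have [->|/set0Pn[a0 Ba0]] := eqVneq B set0.
  rewrite /augment big_set0; split=> [a _|]; last by rewrite submx0.
  by rewrite mul0mx sub0mx.
case: (arg_minnP h Ba0) => a; rewrite -/(a \in B) => Ba a_min.
have Sa : a \in S by apply: subsetP BS _ _.
have [||st_B' pr_B'] := IH (B :\ a) _ (subset_trans (subsetDl _ _) BS).
- by rewrite (cardsD1 a) Ba add1n ltnS in cardB.
- move=> b c; rewrite !inE => /andP[ba Bb] Sc hc; rewrite (Bup b) // andbT.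
  by apply: contraTneq hc => ->; rewrite -leqNgt a_min.
have def_B : augment B V = (augment (B :\ a) V + V *m (y a - 1%:M))%MS.
  by rewrite /augment (big_setD1 a Ba) addsmxC.
have B'_sub b : b \in B :\ a -> (V *m (y b - 1%:M) <= augment (B :\ a) V)%MS.
  by move=> B'b; apply: (sumsmx_sup b).
have st_B : stable (augment B V).
  move=> b Sb; rewrite def_B addsmxMr addsmx_sub.
  rewrite (submx_trans (st_B' b Sb)) ?addsmxSl //=.
  have sub_a U : (U <= V)%MS -> (U *m (y a - 1%:M) <= augment (B :\ a) V + V *m (y a - 1%:M))%MS.
    by move=> UV; apply: submx_trans (addsmxSr _ _); apply: submxMr.
  have Vb U : (U <= V)%MS -> forall d, d \in S -> (U *m y d <= V)%MS.
    by move=> UV d Sd; apply: submx_trans (submxMr _ UV) (Vst d Sd).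
  have B'_st U : (U <= augment (B :\ a) V)%MS -> forall d, d \in S ->
      (U *m y d <= augment (B :\ a) V)%MS.
    by move=> UV d Sd; apply: submx_trans (submxMr _ UV) (st_B' d Sd).
  case: (y_comm Sa Sb) => [yab|[c [Sc ha_c yab]]].
    have -> : V *m (y a - 1%:M) *m y b = V *m y b *m (y a - 1%:M).
      rewrite -!mulmxA; congr (_ *m _).
      by rewrite mulmxBl mulmxBr yab mul1mx mulmx1.
    by apply: sub_a; apply: Vb.
  have B'c : c \in B :\ a.
    rewrite !inE (Bup a) // andbT.
    by apply: contraTneq ha_c => ->; rewrite ltnn.
  case: yab => yab.
    have -> : V *m (y a - 1%:M) *m y b =
        V *m y c *m y b *m (y a - 1%:M) + V *m (y c - 1%:M) *m y b.
      rewrite -!mulmxA -mulmxDr; congr (_ *m _).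
      rewrite !mulmxBl !mulmxBr !mul1mx !mulmx1 yab ?mulmxA.
      by rewrite addrA addrNK.
    apply: addmx_sub; first by apply: sub_a; apply: (Vb _ _ _ _ Sb); apply: Vb.
    by apply: submx_trans (addsmxSl _ _); apply: B'_st => //; apply: B'_sub.
  have -> : V *m (y a - 1%:M) *m y b =
      V *m y b *m (y a - 1%:M) - V *m (y c - 1%:M) *m y a *m y b.
    rewrite -!mulmxA -mulmxBr; congr (_ *m _).
    rewrite !mulmxBl !mulmxBr yab !mul1mx !mulmx1 !mulmxA.
    by rewrite opprB [RHS]addrC addrA addrNK.
  apply: addmx_sub; first by apply: sub_a; apply: Vb.
  rewrite eqmx_opp; apply: submx_trans (addsmxSl _ _).
  by apply: (B'_st _ _ _ _ Sb); apply: (B'_st _ _ _ _ Sa); apply: B'_sub.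
split=> //; rewrite def_B; apply: contra pr_B' => V_sub.
have [k yk] := y_unip Sa.
have V_subk j : (V <= augment (B :\ a) V + V *m (y a - 1%:M) ^+ j)%MS.
  elim: j => [|j IHj]; first by rewrite expr0 mulmx1 addsmxSr.
  apply: submx_trans V_sub _; rewrite addsmx_sub addsmxSl /=.
  apply: submx_trans (submxMr _ IHj) _; rewrite addsmxMr addsmx_sub.
  apply/andP; split; last by rewrite exprSr -mulmxE mulmxA addsmxSr.
  rewrite mulmxBr mulmx1; apply: submx_trans (addsmxSl _ _).
  by rewrite addmx_sub ?eqmx_opp // st_B'.
by have := V_subk k; rewrite yk mulmx0 addsmx0.
Qed.

(** The powers of the augmentation ideal of the group generated by the [y a],
   applied to the natural module. *)
Fixpoint lower k : 'M[F]_n.+1 :=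
  if k is k'.+1 then augment S (lower k') else 1%:M.

Lemma lower_stable k : stable (lower k).
Proof.
elim: k => [|k IH] /=; first by move=> a _; apply: submx1.
have [->|V0] := eqVneq (lower k) 0; last by case: (@augment_proper _ S V0 IH).
move=> a Sa; rewrite /augment big1 ?mul0mx ?sub0mx // => b _.
by rewrite mul0mx.
Qed.

Lemma lower_rank k : lower k != 0 -> (\rank (lower k.+1) < \rank (lower k))%N.
Proof.
move=> V0; have [_ pr] := @augment_proper _ S V0 (lower_stable k) (subxx _) (fun _ _ _ Sc _ => Sc).
apply: rank_ltmx; rewrite /ltmx pr andbT.
apply/sumsmx_subP => a Sa; rewrite mulmxBr mulmx1 addmx_sub ?eqmx_opp //.
exact: lower_stable.
Qed.

Lemma lower_eq0 j k : lower j = 0 -> lower (k + j) = 0.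
Proof.
move=> Lj; elim: k => //= k IH.
by rewrite /augment big1 // => a _; rewrite IH mul0mx.
Qed.

Lemma lower_rank_le k : (k + \rank (lower k) <= n.+1)%N \/ lower k = 0.
Proof.
elim: k => [|k [IH|IH]]; first by left; rewrite mxrank1.
  have [/eqP V0|V0] := boolP (lower k == 0).
    by right; rewrite /= /augment big1 // => a _; rewrite V0 mul0mx.
  by left; rewrite addSnnS (leq_trans _ IH) // leq_add2l lower_rank.
by right; rewrite /= /augment big1 // => a _; rewrite IH mul0mx.
Qed.

(** An invertible matrix that maps [V] into [V] maps it onto [V]. *)
Lemma stable_cancel a (U V : 'M[F]_n.+1) : a \in S -> stable V ->
  (U *m y a <= V)%MS -> (U <= V)%MS.
Proof.
move=> Sa Vst UV; have ya : row_free (y a) by rewrite row_free_unit y_unit.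
rewrite -(submxMfree _ _ ya) (submx_trans UV) //.
have [_] := mxrank_leqif_sup (Vst a Sa).
by rewrite mxrankMfree // eqxx => <-.
Qed.

Hypothesis h_gen : forall a, a \in S -> h a = 1%N \/
  exists b c, [/\ b \in S, c \in S, (0 < h b)%N, (0 < h c)%N &
   h a = (h b + h c)%N /\ y b *m y c = y a *m y c *m y b].

(** A commutator of [y b] and [y c] acts, up to invertible factors, as the Lie
   bracket of [y b - 1] and [y c - 1], so it descends by [h b + h c] steps. *)
Lemma lower_height a k : a \in S ->
  (lower k *m (y a - 1%:M) <= lower (h a + k))%MS.
Proof.
have [m] := ubnP (h a); elim: m => // m IH in a k * => ha Sa.
have [->|[b [c [Sb Sc hb hc [def_h yy]]]]] := h_gen Sa.
  by rewrite add1n /=; apply: (sumsmx_sup a).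
apply: (stable_cancel Sc (lower_stable _)); apply: (stable_cancel Sb (lower_stable _)).
have -> : lower k *m (y a - 1%:M) *m y c *m y b =
    lower k *m (y b - 1%:M) *m (y c - 1%:M) - lower k *m (y c - 1%:M) *m (y b - 1%:M).
  rewrite -!mulmxA -mulmxBr; congr (_ *m _).
  rewrite !mulmxBl !mulmxBr !mul1mx !mulmx1 mulmxA -yy.
  move: (y b *m y c) (y c *m y b) => P Q.
  by apply/matrixP => i j; rewrite !mxE; ring.
have IH2 d e j : d \in S -> e \in S -> (h d < m)%N -> (h e < m)%N ->
    (lower j *m (y d - 1%:M) *m (y e - 1%:M) <= lower (h e + (h d + j)))%MS.
  move=> Sd Se hd he; apply: submx_trans (IH _ _ he Se).
  by apply: submxMr; apply: IH.
have hbm : (h b < m)%N by lia.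
have hcm : (h c < m)%N by lia.
rewrite addmx_sub ?eqmx_opp //.
  by rewrite (_ : h a + k = h c + (h b + k))%N ?IH2 //; lia.
by rewrite (_ : h a + k = h b + (h c + k))%N ?IH2 //; lia.
Qed.

Lemma lower_top : lower n.+1 = 0.
Proof.
by case: (lower_rank_le n.+1) => // H; apply/eqP; rewrite -mxrank_eq0; lia.
Qed.

Lemma top_height_mul0 a b : a \in S -> b \in S -> h a = n -> (0 < h b)%N ->
  (y a - 1%:M) *m (y b - 1%:M) = 0.
Proof.
move=> Sa Sb ha hb; apply/eqP; rewrite -submx0.
have topa : (y a - 1%:M <= lower n)%MS.
  by have := lower_height 0 Sa; rewrite ha addn0 mul1mx.
have := lower_height n Sb; rewrite -(prednK hb) addSnnS (lower_eq0 _ lower_top).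
exact/submx_trans/submxMr.
Qed.

(** The filtration [lower] drops strictly until it vanishes, so it vanishes after
   [n.+1] steps.  Since [y a - 1] is a nonzero map that descends by [n] steps, each
   drop is by exactly one dimension: [y a - 1] and [y b - 1] kill the hyperplane
   [lower 1] and have their image in the line [lower n]. *)
Theorem top_height_proportional a b : a \in S -> b \in S -> h a = n -> h b = n ->
  y a - 1%:M != 0 -> exists z, y b - 1%:M = z *: (y a - 1%:M).
Proof.
move=> Sa Sb ha hb Na0.
have top d : d \in S -> h d = n -> (y d - 1%:M <= lower n)%MS.
  by move=> Sd hd; have := lower_height 0 Sd; rewrite hd addn0 mul1mx.
have lown0 : lower n != 0 by apply: contraNneq Na0 => L0; rewrite -submx0 -L0 top.
have rank_n : (\rank (lower n) <= 1)%N.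
  by case: (lower_rank_le n) => [|L0]; [lia|rewrite L0 eqxx in lown0].
have kill d : d \in S -> h d = n -> lower 1 *m (y d - 1%:M) = 0.
  move=> Sd hd; apply/eqP; rewrite -submx0 -lower_top.
  by have := lower_height 1 Sd; rewrite hd addn1.
have rank_1 : (n <= \rank (lower 1))%N.
  have [n0|n_gt0] := posnP n; first by lia.
  suff H k : (k < n)%N -> (k.+1 <= \rank (lower (n - k)))%N.
    by have := H n.-1; rewrite (_ : n - n.-1 = 1)%N; lia.
  elim: k => [_|k IH kn]; first by rewrite subn0 lt0n mxrank_eq0.
  have Lk0 : lower (n - k.+1) != 0.
    apply: contraNneq lown0 => Lk0.
    by have := lower_eq0 k.+1 Lk0; rewrite (subnKC (ltnW kn)) => ->.
  by have := lower_rank Lk0; rewrite (subnSK (ltnW kn)); have := IH (ltnW kn); lia.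
exact: rank1_proportional Na0 (top _ Sa ha) (top _ Sb hb) rank_n (kill _ Sa ha)
  (kill _ Sb hb) rank_1.
Qed.

End Unitriangular.

(** * Transvections and bounded generation *)

Section Transvections.
Variables (n : nat) (F : fieldType).
Implicit Types (i j m : 'I_n) (a b : F) (A B : SL n F).

(** The coefficient is dropped on the diagonal, so that the determinant is [1] for
   all [i] and [j]. *)
Definition transv_mx i j a : 'M[F]_n := 1%:M + (a *+ (i != j)) *: delta_mx i j.

Fact det_transv i j a : \det (transv_mx i j a) == 1.
Proof.
rewrite /transv_mx; have [<-|ij] := eqVneq i j.
  by rewrite /= mulr0n scale0r addr0 det1.
rewrite mulr1n.
wlog lt_ji : i j ij / (j < i)%N => [IH|].
  have [|le_ij] := ltnP j i; first exact: IH.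
  rewrite -det_tr linearD /= trmx1 linearZ /= trmx_delta; apply: IH; first by rewrite eq_sym.
  by rewrite ltn_neqAle le_ij andbT.
rewrite det_trig.
  by apply/eqP/big1 => k _; rewrite !mxE eqxx; case: eqVneq => [->|];
    rewrite ?(negPf ij) mulr0 addr0.
apply/is_trig_mxP => k l kl; rewrite !mxE.
case: eqVneq => [kl'|_]; first by rewrite kl' ltnn in kl.
case: eqVneq => [ki|]; case: eqVneq => [lj|]; rewrite ?mulr0 ?addr0 //.
by rewrite ki lj ltnNge (ltnW lt_ji) in kl.
Qed.

Definition transv (ij : 'I_n * 'I_n) a : SL n F := MkSL (det_transv ij.1 ij.2 a).

(** The positions in [s] are fixed and only the coefficients vary: membership is
   then expressible by a formula of length bounded in terms of [s]. *)
Fixpoint reach (s : seq ('I_n * 'I_n)) A : Prop :=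
  match s with
  | [::] => A = 1%g
  | ij :: s' => exists a B, A = (transv ij a * B)%g /\ reach s' B
  end.

Lemma reach_cat s t A B : reach s A -> reach t B -> reach (s ++ t) (A * B)%g.
Proof.
elim: s A => [A ->|ij s IH A [a [A' [-> sA']]] tB]; first by rewrite mul1g.
by exists a, (A' * B)%g; split; [rewrite mulgA|apply: IH].
Qed.

Lemma reach_prod (I : Type) (r : seq I) (f : I -> 'I_n * 'I_n) (v : I -> F) :
  reach [seq f x | x <- r] (\prod_(x <- r) transv (f x) (v x))%g.
Proof.
elim: r => [|x r IH] /=; first by rewrite big_nil.
by exists (v x), (\prod_(x <- r) transv (f x) (v x))%g; rewrite big_cons.
Qed.

Lemma reach_filter s A : reach s A -> reach [seq ij <- s | ij.1 != ij.2] A.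
Proof.
elim: s A => //= -[i j] s IH A [a [B [-> sB]]] /=; case: (eqVneq i j) => [<-|ij] /=.
  have -> : transv (i, i) a = 1%g.
    by apply: val_inj; rewrite /= /transv_mx eqxx /= ?mulr0n scale0r addr0.
  by rewrite mul1g; apply: IH.
by exists a, B; split=> //; apply: IH.
Qed.

Lemma reach_word s A : reach s A ->
  exists t : 'I_(size s) -> F,
    A = (\prod_(k < size s) transv (tnth (in_tuple s) k) (t k))%g.
Proof.
elim: s A => [A ->|ij s IH A [a [B [-> /IH[t ->]]]]].
  by exists (fun _ => 0); rewrite big_ord0.
exists (fun k => oapp t a (unlift ord0 k)).
rewrite big_ord_recl unlift_none /=; congr (_ * _)%g.
apply: eq_bigr => k _; rewrite liftK /=; congr transv.
by rewrite !(tnth_nth ij).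
Qed.

Definition row_op m (v : 'I_n -> F) : SL n F := (\prod_(j <- enum 'I_n) transv (m, j) (v j))%g.
Definition col_op m (v : 'I_n -> F) : SL n F := (\prod_(i <- enum 'I_n) transv (i, m) (v i))%g.
Definition row_path m := [seq (m, j) | j <- enum 'I_n].
Definition col_path m := [seq (i, m) | i <- enum 'I_n].

Lemma row_opE m v : row_op m v = 1%:M + \sum_j (v j *+ (m != j)) *: delta_mx m j :> 'M_n.
Proof.
rewrite -[in RHS]big_enum /row_op; elim: (enum 'I_n) => [|j r IH].
  by rewrite !big_nil addr0.
rewrite !big_cons /= IH /transv_mx mulmxDl mul1mx mulmxDr mulmx1.
have -> : (v j *+ (m != j)) *: delta_mx m j *m
    (\sum_(k <- r) (v k *+ (m != k)) *: delta_mx m k) = 0.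
  rewrite mulmx_sumr big1 // => k _.
  rewrite -scalemxAl -scalemxAr mul_delta_mx_cond.
  by case: (eqVneq m j) => [->|]; rewrite ?eqxx /= ?mulr0n ?(scale0r, scaler0) // => /negPf mj; rewrite eq_sym mj mulr0n !scaler0.
by rewrite addr0 -addrA [X in _ + X = _]addrC.
Qed.

Lemma col_opE m v : col_op m v = 1%:M + \sum_j (v j *+ (j != m)) *: delta_mx j m :> 'M_n.
Proof.
rewrite -[in RHS]big_enum /col_op; elim: (enum 'I_n) => [|j r IH].
  by rewrite !big_nil addr0.
rewrite !big_cons /= IH /transv_mx mulmxDl mul1mx mulmxDr mulmx1.
have -> : (v j *+ (j != m)) *: delta_mx j m *m
    (\sum_(k <- r) (v k *+ (k != m)) *: delta_mx k m) = 0.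
  rewrite mulmx_sumr big1 // => k _.
  rewrite -scalemxAl -scalemxAr mul_delta_mx_cond.
  by case: (eqVneq k m) => [->|]; rewrite ?eqxx /= ?mulr0n ?(scale0r, scaler0) // => /negPf mj; rewrite eq_sym mj mulr0n !scaler0.
by rewrite addr0 -addrA [X in _ + X = _]addrC.
Qed.

Lemma row_op_entry m v i j :
  row_op m v i j = (i == j)%:R + (v j *+ (m != j)) *+ (i == m).
Proof.
rewrite row_opE !mxE summxE (bigD1 j) //= big1 ?addr0 => [|k kj].
  by rewrite !mxE eqxx andbT mulr_natr.
by rewrite !mxE [j == k]eq_sym (negPf kj) andbF mulr0.
Qed.

Lemma col_op_entry m v i j :
  col_op m v i j = (i == j)%:R + (v i *+ (i != m)) *+ (j == m).
Proof.
rewrite col_opE !mxE summxE (bigD1 i) //= big1 ?addr0 => [|k ki].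
  by rewrite !mxE eqxx mulr_natr.
by rewrite !mxE [i == k]eq_sym (negPf ki) mulr0.
Qed.

Lemma sum_delta (f : 'I_n -> F) i : \sum_k (i == k)%:R * f k = f i.
Proof.
rewrite (bigD1 i) //= eqxx mul1r big1 ?addr0 // => k ki.
by rewrite eq_sym (negPf ki) mul0r.
Qed.

Lemma row_op_mulE m v A i j :
  (row_op m v * A)%g i j = A i j + (\sum_k (v k *+ (m != k)) * A k j) *+ (i == m).
Proof.
rewrite [LHS]mxE -[in RHS](sum_delta (A^~ j) i) -sumrMnl -big_split /=.
by apply: eq_bigr => k _; rewrite row_op_entry mulrDl; congr (_ + _); rewrite mulrnAl.
Qed.

Lemma col_op_mulE m v A i j :
  (col_op m v * A)%g i j = A i j + v i *+ (i != m) * A m j.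
Proof.
rewrite [LHS]mxE -[in RHS](sum_delta (A^~ j) i) -(sum_delta (fun k => _ * A k j) m).
rewrite -big_split /=; apply: eq_bigr => k _; rewrite col_op_entry.
rewrite [k == m]eq_sym mulrDl; congr (_ + _).
by have [<-|_] := eqVneq m k; rewrite ?mulr1n ?mul1r ?mulr0n ?mul0r.
Qed.

Lemma mul_row_opE m v A i j :
  (A * row_op m v)%g i j = A i j + A i m * (v j *+ (m != j)).
Proof.
rewrite [LHS]mxE -[in RHS](sum_delta (A i) j) -(sum_delta (fun k => A i k * _) m).
rewrite -big_split /=; apply: eq_bigr => k _; rewrite row_op_entry mulrDr.
rewrite [k == m]eq_sym [k == j]eq_sym; congr (_ + _); first by rewrite mulrC.
have [<-|_] := eqVneq m k; rewrite ?mulr1n ?mul1r ?mulr0n ?mul0r ?mulr0 //.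
by rewrite eq_sym.
Qed.

Lemma transv0 ij : transv ij 0 = 1%g.
Proof. by apply: val_inj; rewrite /= /transv_mx mul0rn scale0r addr0. Qed.

Lemma transvD ij a b : transv ij (a + b) = (transv ij a * transv ij b)%g.
Proof.
apply: val_inj; rewrite /= /transv_mx; have [_|neq_ij] /= := eqVneq ij.1 ij.2.
  by rewrite !mulr0n !scale0r !addr0 mul1mx.
rewrite !mulr1n mulmxDl mul1mx mulmxDr mulmx1 -scalemxAl -scalemxAr.
rewrite mul_delta_mx_cond [ij.2 == _]eq_sym (negPf neq_ij) mulr0n !scaler0 addr0.
by rewrite scalerDl addrA addrAC.
Qed.

Lemma transvV ij a : (transv ij a)^-1%g = transv ij (- a).
Proof. by apply: (mulgI (transv ij a)); rewrite mulgV -transvD subrr transv0. Qed.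

Lemma reach_inv s A : reach s A -> reach (rev s) A^-1%g.
Proof.
elim: s A => [A ->|ij s IH A [a [B [-> /IH sB]]]] /=; first by rewrite invg1.
rewrite rev_cons -cats1 invgM; apply: reach_cat => //=.
by exists (- a), 1%g; rewrite transvV mulg1.
Qed.

(** Equality with the identity outside the leading square block of size [k]. *)
Definition block k A :=
  forall i j : 'I_n, (k <= i)%N || (k <= j)%N -> A i j = (i == j)%:R.

Lemma block0 A : block 0 A -> A = 1%g.
Proof. by move=> bA; apply: val_inj; apply/matrixP => i j; rewrite !mxE bA. Qed.

Lemma block1 (i0 : 'I_n) A : i0 = 0%N :> nat -> block 1 A -> A = 1%g.
Proof.
move=> i00 bA.
have off i j : (i0 != i) || (i0 != j) -> A i j = (i == j)%:R.
  rewrite -2!val_eqE /= i00 => nz; apply: bA.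
  by rewrite !lt0n ![_ == 0%N]eq_sym.
apply: block0 => i j _; have [|] := boolP ((i0 != i) || (i0 != j)); first exact: off.
rewrite negb_or !negbK => /andP[/eqP<- /eqP<-]; rewrite eqxx.
rewrite -[RHS](det_SL A) det_trig.
  rewrite (bigD1 i0) //= big1 ?mulr1 // => k ki.
  by rewrite off ?eqxx // eq_sym ki.
apply/is_trig_mxP => k l kl; rewrite off; first by rewrite -val_eqE /= ltn_eqF.
by rewrite -negb_and; apply: contraTN kl => /andP[/eqP<- /eqP<-]; rewrite ltnn.
Qed.

(** The first row operation, at index [i0], only serves to make sure that the
   pivot column [m] has a nonzero entry off the diagonal. *)
Definition clear_path (i0 m : 'I_n) s :=
  rev (row_path i0) ++ rev (row_path m) ++ rev (col_path m) ++ s ++ rev (row_path m).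

(** Make the corner entry of the block equal to [1] by row operations, then clear
   its column by row operations and its row by column operations. *)
Lemma reach_block_step (i0 m : 'I_n) s : (i0 < m)%N ->
  (forall A, block m A -> reach s A) ->
  forall A, block m.+1 A -> reach (clear_path i0 m s) A.
Proof.
move=> i0m reach_s A bA.
have neq_i0m : i0 != m by rewrite -val_eqE /= ltn_eqF.
have mE : m == m by [].
(* If column [m] vanishes off the diagonal then row [m] is added to row [i0]. *)
pose v1 k : F := ((k == m) && [forall i : 'I_n, (i != m) ==> (A i m == 0)])%:R.
pose B1 := (row_op i0 v1 * A)%g.
have B1E i j : B1 i j = A i j + (v1 m * A m j) *+ (i == i0).
  rewrite /B1 row_op_mulE (bigD1 m) //= neq_i0m mulr1n big1 ?addr0 // => k km.
  by rewrite /v1 (negPf km) mul0rn mul0r.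
have bB1 : block m.+1 B1.
  move=> i j ij; rewrite B1E bA //.
  case: (eqVneq i i0) ij => [->|_]; last by rewrite mulr0n addr0.
  case/orP => [|jm]; first by rewrite ltnNge (ltnW i0m).
  rewrite (bA m j) ?jm ?orbT // mulr1n.
  by rewrite (_ : m == j = false) ?mulr0 ?addr0 // -val_eqE /= ltn_eqF.
have [l lm B1l] : exists2 l, l != m & B1 l m != 0.
  have [A0|] := boolP [forall i : 'I_n, (i != m) ==> (A i m == 0)].
    exists i0 => //; rewrite B1E eqxx /v1 eqxx A0 mul1r mulr1n.
    have /eqP -> : A i0 m == 0 by move/forallP: A0 => /(_ i0) /implyP ->.
    rewrite add0r; apply: contraTneq (SL_unitmx A) => Am.
    rewrite unitmxE unitfE negbK (expand_det_col _ m) big1 // => i _.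
    have [->|im] := eqVneq i m; first by rewrite Am mul0r.
    by move/forallP: A0 => /(_ i) /implyP /(_ im) /eqP ->; rewrite mul0r.
  move=> nA0; have := nA0; rewrite negb_forall => /existsP[i].
  rewrite negb_imply => /andP[im Aim]; exists i => //.
  by rewrite B1E /v1 (negPf nA0) andbF mul0r mul0rn addr0.
pose v2 k := if k == l then (1 - B1 m m) / B1 l m else 0.
pose B2 := (row_op m v2 * B1)%g.
have B2E i j : B2 i j = B1 i j + (v2 l * B1 l j) *+ (i == m).
  rewrite /B2 row_op_mulE (bigD1 l) //= eq_sym lm mulr1n big1 ?addr0 // => k kl.
  by rewrite /v2 (negPf kl) mul0rn mul0r.
have l_le : (l < m.+1)%N.
  rewrite ltnS leqNgt; apply: contra B1l => ml.
  by rewrite bB1 ?(negPf lm) // ml.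
have bB2 : block m.+1 B2.
  move=> i j ij; rewrite B2E bB1 //.
  case: (eqVneq i m) ij => [->|_]; last by rewrite mulr0n addr0.
  rewrite ltnn /= => jm; rewrite (bB1 l j) ?jm ?orbT // mulr1n.
  by rewrite (_ : l == j = false) ?mulr0 ?addr0 // -val_eqE /= ltn_eqF // (leq_trans l_le).
have B2mm : B2 m m = 1 by rewrite B2E eqxx /v2 eqxx divfK // mulr1n addrC subrK.
pose B3 := (col_op m (fun i => - B2 i m) * B2)%g.
have B3E i j : B3 i j = B2 i j - B2 i m *+ (i != m) * B2 m j.
  by rewrite /B3 col_op_mulE mulNrn mulNr.
have B3m i : B3 i m = (i == m)%:R.
  rewrite B3E B2mm mulr1; have [->|] := eqVneq i m; first by rewrite subr0 B2mm.
  by rewrite mulr1n subrr.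
pose B4 := (B3 * row_op m (fun j => - B3 m j))%g.
have B4E i j : B4 i j = B3 i j - B3 i m * (B3 m j *+ (m != j)).
  by rewrite /B4 mul_row_opE mulNrn mulrN.
have bB4 : block m B4.
  move=> i j; rewrite B4E B3m.
  have [->|im] := eqVneq i m.
    have [<-|mj] := eqVneq m j; first by rewrite mulr0n mulr0 subr0 B3m eqxx.
    by rewrite mul1r mulr1n subrr.
  rewrite mul0r subr0 B3E im mulr1n.
  have [->|jm] := eqVneq j m; first by rewrite B2mm mulr1 subrr (negPf im).
  have lt_m (x : 'I_n) : x != m -> (m <= x)%N -> (m < x)%N.
    by rewrite -val_eqE /= => xm mx; rewrite ltn_neqAle eq_sym xm.
  case/orP => [/(lt_m _ im) mi|/(lt_m _ jm) mj].
    by rewrite (bB2 i j) ?mi // (bB2 i m) ?mi // (negPf im) mul0r subr0.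
  by rewrite (bB2 i j) ?mj ?orbT // (bB2 m j) ?mj ?orbT // [m == j]eq_sym (negPf jm)
    mulr0 subr0.
have -> : A = ((row_op i0 v1)^-1 * ((row_op m v2)^-1 *
    ((col_op m (fun i => - B2 i m))^-1 * (B4 * (row_op m (fun j => - B3 m j))^-1))))%g.
  by rewrite /B4 mulgK /B3 mulKg /B2 mulKg /B1 mulKg.
do 3![apply: reach_cat; first by apply: reach_inv; apply: reach_prod].
by apply: reach_cat; [apply: reach_s|apply: reach_inv; apply: reach_prod].
Qed.

End Transvections.

(** In a block of size one the determinant condition leaves only the identity, so
   no diagonal matrices have to be generated. *)
Lemma reach_block n k : (k <= n)%N ->
  exists s, forall (F : fieldType) (A : SL n F), block k A -> reach s A.
Proof.
elim: k => [_|k IH kn]; first by exists [::] => F A /block0.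
have i0P : (0 < n)%N by apply: leq_trans kn.
have [k0|k_gt0] := posnP k.
  by exists [::] => F A; rewrite k0; apply: (@block1 _ _ (Ordinal i0P)).
have [s Hs] := IH (ltnW kn).
exists (clear_path (Ordinal i0P) (Ordinal kn) s) => F A.
by apply: (@reach_block_step _ F (Ordinal i0P) (Ordinal kn)) => // B; apply: Hs.
Qed.

(** Gaussian elimination, with vacuous operations included, is the same sequence
   of row and column operations for all matrices of a given size. *)
Theorem bounded_generation n : exists s : seq ('I_n * 'I_n),
  all (fun ij => ij.1 != ij.2) s /\
  forall (F : fieldType) (A : SL n F), exists t : 'I_(size s) -> F,
    A = (\prod_(k < size s) transv (tnth (in_tuple s) k) (t k))%g.
Proof.
have [s Hs] := reach_block (leqnn n).
exists [seq ij <- s | ij.1 != ij.2]; split; first exact: filter_all.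
move=> F A; apply/reach_word/reach_filter/Hs => i j.
by rewrite (leqNgt n i) (leqNgt n j) !ltn_ord.
Qed.

(** * Coordinate fields in groups *)

Definition field_carrier (T : choiceType) : Type := T.
HB.instance Definition _ (T : choiceType) := Choice.on (field_carrier T).

Lemma fieldType_of_axioms (T : choiceType) (zero one : T) (opp : T -> T)
    (add mul : T -> T -> T) :
  associative add -> commutative add -> left_id zero add -> left_inverse zero opp add ->
  associative mul -> commutative mul -> left_id one mul -> left_distributive mul add ->
  one != zero -> (forall x, x != zero -> exists y, mul y x = one) ->
  exists (L : fieldType) (c : L -> T), [/\ bijective c, c 1 = one,
    {morph c : x y / x + y >-> add x y} & {morph c : x y / x * y >-> mul x y}].
Proof.
move=> addA addC add0 addN mulA mulC mul1 mulD one0 mulV.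
have inv_ex x : exists y, (if x == zero then y == zero else mul y x == one).
  have [_|/mulV[y <-]] := eqVneq x zero; first by exists zero.
  by exists y.
have [inv invS] : exists inv : T -> T,
    forall x, if x == zero then inv x == zero else mul (inv x) x == one.
  by exists (fun x => xchoose (inv_ex x)) => x; apply: (xchooseP (inv_ex x)).
have invP x : x != zero -> mul (inv x) x = one.
  by move=> x0; have := invS x; rewrite (negPf x0) => /eqP.
have inv0 : inv zero = zero by have := invS zero; rewrite eqxx => /eqP.
pose Z : zmodType := HB.pack (field_carrier T) (GRing.isZmodule.Build (field_carrier T) addA addC add0 addN).
pose R : comNzRingType := HB.pack (field_carrier T) Z
  (GRing.Zmodule_isComNzRing.Build Z mulA mulC mul1 mulD one0).
pose L : fieldType := HB.pack (field_carrier T) R (GRing.ComNzRing_isField.Build R invP inv0).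
by exists L, id; split=> //; exists id.
Qed.

Section Coordinates.
Variable n : nat.
Local Notation I := ('I_n.+3 * 'I_n.+3)%type.

(** [SL n.+3] has the row indices [0], [1] and [max], which are distinct. *)
Definition ix0 : 'I_n.+3 := ord0.
Definition ix1 : 'I_n.+3 := Ordinal (isT : 1 < n.+3)%N.
Definition ixm : 'I_n.+3 := ord_max.

Section Params.
Variables (G : groupType) (p : option I -> G).
Implicit Types x y z g : G.

Local Open Scope group_scope.

Definition cnj g x : G := g * x * g^-1.
(** The parameter [p None] is the coordinate element [1], and [p (Some (i, j))]
   conjugates the root subgroup at [(ix0, ixm)] to the one at [(i, j)]. *)
Definition unt : G := p None.
Definition rootelt (ij : I) x : G := cnj (p (Some ij)) x.
Definition rmul x y : G :=
  rootelt (ix0, ix1) x * rootelt (ix1, ixm) y * (rootelt (ix0, ix1) x)^-1 * (rootelt (ix1, ixm) y)^-1.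

(** For the standard parameters of [SL n.+3 F], with [p (Some (i, j))] as just
   described, the commutation conditions say that [z] is a scalar matrix times
   an element of the root subgroup at [(ix0, ixm)].  A commutator does not see
   the scalar factor, so the equation [rmul z unt = z] removes it. *)
Definition is_coord z : bool :=
  [&& [forall j, (j != ix0) ==> (z * rootelt (ix0, j) unt == rootelt (ix0, j) unt * z)],
      [forall i, (i != ixm) ==> (z * rootelt (i, ixm) unt == rootelt (i, ixm) unt * z)] &
      rmul z unt == z].

Lemma is_coordP z : is_coord z <->
  (forall j, j != ix0 -> z * rootelt (ix0, j) unt = rootelt (ix0, j) unt * z) /\
  (forall i, i != ixm -> z * rootelt (i, ixm) unt = rootelt (i, ixm) unt * z) /\
  rmul z unt = z.
Proof.
split=> [/and3P[/forallP H1 /forallP H2 /eqP H3]|[H1 [H2 H3]]].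
  split; [|split] => // [j j0|i im]; apply/eqP.
    by have := H1 j; rewrite j0.
  by have := H2 i; rewrite im.
apply/and3P; split; last exact/eqP.
  by apply/forallP => j; apply/implyP => j0; rewrite H1.
by apply/forallP => i; apply/implyP => im; rewrite H2.
Qed.

Definition field_axioms : Prop :=
  is_coord 1 /\ is_coord unt /\ unt <> 1 /\
  (forall x, is_coord x -> is_coord (x^-1) /\ rmul unt x = x /\
    (x <> 1 -> exists y, is_coord y /\ rmul y x = unt)) /\
  (forall x y, is_coord x -> is_coord y ->
    is_coord (x * y) /\ is_coord (rmul x y) /\ x * y = y * x /\ rmul x y = rmul y x) /\
  (forall x y z, is_coord x -> is_coord y -> is_coord z ->
    rmul x (rmul y z) = rmul (rmul x y) z /\ rmul (x * y) z = rmul x z * rmul y z).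

(** The relation for [j = k] involves the product [rmul], which is itself defined by
   the commutator of the root elements at [(ix0, ix1)] and [(ix1, ixm)]. *)
Definition steinberg : Prop :=
  (forall x, is_coord x -> rootelt (ix0, ixm) x = x) /\
  (forall i j k l : 'I_n.+3, i != j -> k != l -> i != l ->
    forall x y, is_coord x -> is_coord y ->
    if j == k then
      rootelt (i, j) x * rootelt (k, l) y = rootelt (i, l) (rmul x y) * rootelt (k, l) y * rootelt (i, j) x
    else rootelt (i, j) x * rootelt (k, l) y = rootelt (k, l) y * rootelt (i, j) x).

(** The argument encodes a characteristic: [Some r] for a prime [r], [None] for
   zero.  The bound on [k] is the one of [unipotent_of_power_traces]. *)
Definition unipotence (charF : option nat) : Prop :=
  forall x, is_coord x ->
  if charF is Some r then x ^+ r = 1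
  else forall k : 'I_n.+4.+1, (0 < k)%N -> exists g, cnj g x = x ^+ k.

(** The field is not constructed here but arbitrary, so that one set of
   parameters can be shown to code a field given beforehand. *)
Definition field_code (L : fieldType) (c : L -> G) : Prop :=
  [/\ injective c, (forall z, is_coord z <-> exists a, c a = z), c 1%R = unt,
      (forall a b, c (a + b)%R = c a * c b) & (forall a b, c (a * b)%R = rmul (c a) (c b))].

Lemma field_code_coord (L : fieldType) (c : L -> G) a : field_code c -> is_coord (c a).
Proof. by case=> _ dc _ _ _; apply/dc; exists a. Qed.

Lemma field_code0 (L : fieldType) (c : L -> G) : field_code c -> c 0%R = 1.
Proof. by case=> _ _ _ cD _; apply: (mulgI (c 0%R)); rewrite -cD addr0 mulg1. Qed.

Lemma field_codeN (L : fieldType) (c : L -> G) a : field_code c -> c (- a)%R = (c a)^-1.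
Proof.
move=> cP; apply: (mulgI (c a)); rewrite mulgV -(field_code0 cP).
by case: cP => _ _ _ <- _; rewrite subrr.
Qed.

Lemma field_axioms_of_code (L : fieldType) (c : L -> G) : field_code c -> field_axioms.
Proof.
move=> cP; have c0 := field_code0 cP; have cN a := field_codeN a cP.
have dc a := field_code_coord a cP.
case: (cP) => c_inj dP c1 cD cM.
split; first by rewrite -c0.
split; first by rewrite -c1.
split; first by rewrite -c0 -c1 => /c_inj/eqP; rewrite oner_eq0.
split=> [x /dP[a <-]|].
  rewrite -cN -c1 -cM mul1r; split=> //; split=> // ca1.
  have a0 : a != 0%R by apply/eqP => a0; apply: ca1; rewrite a0.
  by exists (c a^-1%R); rewrite -cM mulVf.
split=> [x y /dP[a <-] /dP[b <-]|x y z /dP[a <-] /dP[b <-] /dP[d <-]].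
  by rewrite -!cM -!cD addrC mulrC.
by rewrite -!(cM, cD) mulrA mulrDl.
Qed.

Lemma code_of_field_axioms : field_axioms ->
  exists (L : fieldType) (c : L -> G), field_code c.
Proof.
move=> [d1 [du [u1 [ax1 [ax2 ax3]]]]].
pose T := {x | is_coord x}.
have dinv (x : T) : is_coord ((val x)^-1) by case: (ax1 _ (valP x)).
have dmul (x y : T) : is_coord (val x * val y) by case: (ax2 _ _ (valP x) (valP y)).
have drmul (x y : T) : is_coord (rmul (val x) (val y)).
  by case: (ax2 _ _ (valP x) (valP y)) => _ [].
pose zero : T := Sub 1 d1; pose one : T := Sub unt du.
pose opp (x : T) : T := Sub ((val x)^-1) (dinv x).
pose add (x y : T) : T := Sub (val x * val y) (dmul x y).
pose mul (x y : T) : T := Sub (rmul (val x) (val y)) (drmul x y).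
have [||||||||||L [c [[c' cK c'K] c1 cD cM]]] :=
    @fieldType_of_axioms T zero one opp add mul.
- by move=> x y z; apply: val_inj; apply: mulgA.
- by move=> x y; apply: val_inj; case: (ax2 _ _ (valP x) (valP y)) => _ [_ []].
- by move=> x; apply: val_inj; apply: mul1g.
- by move=> x; apply: val_inj; apply: mulVg.
- by move=> x y z; apply: val_inj; case: (ax3 _ _ _ (valP x) (valP y) (valP z)).
- by move=> x y; apply: val_inj; case: (ax2 _ _ (valP x) (valP y)) => _ [_ [_]].
- by move=> x; apply: val_inj; case: (ax1 _ (valP x)) => _ [].
- by move=> x y z; apply: val_inj; case: (ax3 _ _ _ (valP x) (valP y) (valP z)).
- by rewrite -val_eqE; apply/eqP.
- move=> x; rewrite -val_eqE /= => /eqP x1.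
  case: (ax1 _ (valP x)) => _ [_ /(_ x1)[y [dy yx]]].
  by exists (Sub y dy); apply: val_inj.
exists L, (fun a => val (c a)); split=> [a b /val_inj/(can_inj cK) //|z||a b|a b].
- split=> [dz|[a <-]]; last exact: valP.
  by exists (c' (Sub z dz)); rewrite c'K.
- by rewrite c1.
- by rewrite cD.
- by rewrite cM.
Qed.

End Params.
End Coordinates.

(** * Definability of the conditions on parameters *)

Section GroupTerms.
Variables (S : Type) (GG : S -> groupType).
Local Notation M := (fun s => group_structure (GG s)).
Variable V : Type.
Implicit Types f g : forall s, (V -> GG s) -> GG s.
Local Notation gdef := (@tdefinable group_language S M V).
Local Open Scope group_scope.

Lemma gdef_1 : gdef (fun s _ => 1 : GG s).
Proof. by exists (@App group_language V GOne (fun i => False_rect _ (notF (ltn_ord i)))). Qed.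

Lemma gdef_inv f : gdef f -> gdef (fun s e => (f s e)^-1).
Proof.
by move=> [t Ht]; exists (@App group_language V GInv (fun=> t)) => s e /=; rewrite Ht.
Qed.

Lemma gdef_mul f g : gdef f -> gdef g -> gdef (fun s e => f s e * g s e).
Proof.
move=> [t Ht] [u Hu].
exists (@App group_language V GMul (fun i : 'I_2 => if i == ord0 then t else u)) => s e /=.
by rewrite Ht Hu.
Qed.

Lemma gdef_exp f k : gdef f -> gdef (fun s e => f s e ^+ k).
Proof.
move=> df; elim: k => [|k IH]; first exact: gdef_1.
by apply: tdef_ext (gdef_mul df IH) => s e; rewrite expgS.
Qed.

Lemma gdef_prod (J : Type) (r : seq J) (f : J -> forall s, (V -> GG s) -> GG s) :
  (forall j, gdef (f j)) -> gdef (fun s e => \prod_(j <- r) f j s e).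
Proof.
move=> df; elim: r => [|j r IH].
  by apply: tdef_ext gdef_1 => s e; rewrite big_nil.
by apply: tdef_ext (gdef_mul (df j) IH) => s e; rewrite big_cons.
Qed.

Lemma gdef_cnj f g : gdef f -> gdef g -> gdef (fun s e => cnj (f s e) (g s e)).
Proof. by move=> df dg; apply: gdef_mul (gdef_mul df dg) (gdef_inv df). Qed.

Section Params.
Variable n : nat.
Local Notation I := ('I_n.+3 * 'I_n.+3)%type.
Variable P : forall s, (V -> GG s) -> option I -> GG s.
Hypothesis dP : forall w, gdef (fun s e => P e w).

Lemma gdef_root ij f : gdef f -> gdef (fun s e => rootelt (P e) ij (f s e)).
Proof. by move=> df; apply: gdef_cnj. Qed.

Lemma gdef_unt : gdef (fun s e => unt (P e)).
Proof. exact: dP. Qed.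

Lemma gdef_rmul f g : gdef f -> gdef g -> gdef (fun s e => rmul (P e) (f s e) (g s e)).
Proof.
move=> df dg; apply: gdef_mul; [apply: gdef_mul; [apply: gdef_mul|]|];
  try (apply: gdef_inv); exact: gdef_root.
Qed.

Lemma def_is_coord f : gdef f -> definable (M := M) (fun s e => is_true (is_coord (P e) (f s e))).
Proof.
move=> df.
apply: (@def_ext _ _ M V (fun s e =>
  (forall j, j != ix0 n -> f s e * rootelt (P e) (ix0 n, j) (unt (P e)) =
     rootelt (P e) (ix0 n, j) (unt (P e)) * f s e) /\
  (forall i, i != ixm n -> f s e * rootelt (P e) (i, ixm n) (unt (P e)) =
     rootelt (P e) (i, ixm n) (unt (P e)) * f s e) /\
  rmul (P e) (f s e) (unt (P e)) = f s e)).
  by move=> s e; symmetry; apply: is_coordP.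
apply: def_and; last apply: def_and.
- apply: def_forall_fin => j; apply: def_cond => _; apply: def_eq; apply: gdef_mul => //;
    apply: gdef_root; apply: gdef_unt.
- apply: def_forall_fin => j; apply: def_cond => _; apply: def_eq; apply: gdef_mul => //;
    apply: gdef_root; apply: gdef_unt.
- by apply: def_eq => //; apply: gdef_rmul => //; apply: gdef_unt.
Qed.

End Params.
End GroupTerms.

(* Closes the definability goals of conditions written with the constructions
   above; what remains are case distinctions made outside the logic. *)
Ltac gdefs := first
  [ match goal with |- definable (fun s e => _ /\ _) => apply: def_and; gdefs end
  | match goal with |- definable (fun s e => ~ _) => apply: def_not; gdefs end
  | match goal with |- definable (fun s e => is_true (is_coord _ _)) => apply: def_is_coord; gdefs end
  | match goal with |- definable (fun s e => _ -> _) => apply: def_imp; gdefs end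
  | match goal with |- definable (fun s e => _ = _) => apply: def_eq; gdefs end
  | match goal with |- definable (fun s e => forall x, _) => apply: def_all; gdefs end
  | match goal with |- definable (fun s e => exists x, _) => apply: def_ex; gdefs end
  | match goal with |- tdefinable (fun s e => 1%g) => exact: gdef_1 end
  | match goal with |- tdefinable (fun s e => (_^-1)%g) => apply: gdef_inv; gdefs end
  | match goal with |- tdefinable (fun s e => (_ * _)%g) => apply: gdef_mul; gdefs end
  | match goal with |- tdefinable (fun s e => (_ ^+ _)%g) => apply: gdef_exp; gdefs end
  | match goal with |- tdefinable (fun s e => rmul _ _ _) => apply: gdef_rmul; gdefs end
  | match goal with |- tdefinable (fun s e => rootelt _ _ _) => apply: gdef_root; gdefs end
  | match goal with |- tdefinable (fun s e => cnj _ _) => apply: gdef_cnj; gdefs end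
  | match goal with |- tdefinable (fun s e => unt _) => apply: gdef_unt; gdefs end
  | match goal with |- forall w : option _, _ => move=> ?; gdefs end
  | by eexists (Var _) => ? ? /=; reflexivity
  | idtac ].

Section FrameConditions.
Variable n : nat.
Local Notation I := ('I_n.+3 * 'I_n.+3)%type.
Local Notation W := (option I).
Local Notation M := (fun G : groupType => group_structure G).
Local Open Scope group_scope.

Lemma def_field_axioms : definable (M := M) (fun G (p : W -> G) => field_axioms p).
Proof. by rewrite /field_axioms; gdefs. Qed.

Lemma def_steinberg : definable (M := M) (fun G (p : W -> G) => steinberg p).
Proof.
rewrite /steinberg; apply: def_and; first by gdefs.
apply: def_forall_fin => i; apply: def_forall_fin => j.
apply: def_forall_fin => k; apply: def_forall_fin => l.
do 3![apply: def_cond => _].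
by case: (j == k); gdefs.
Qed.

Lemma def_unipotence charF : definable (M := M) (fun G (p : W -> G) => unipotence p charF).
Proof.
rewrite /unipotence; case: charF => [r|]; first by gdefs.
apply: def_all; apply: def_imp; first by gdefs.
by apply: def_forall_fin => k; apply: def_cond => _; gdefs.
Qed.

End FrameConditions.

(** * Groups presented as SL over their coordinate field *)

Section CoordinateInterpretation.
Variable n : nat.
Local Notation I := ('I_n.+3 * 'I_n.+3)%type.

(** The family over which the interpretation of the field in the group is uniform. *)
Record coordinatized := Coordinatized {
  cgroup : groupType;
  cparam : option I -> cgroup;
  cfield : fieldType;
  ccode : cfield -> cgroup;
  ccodeP : field_code cparam ccode
}.

Lemma coord_interpretation V (phi : formula ring_language V) :
  exists psi : formula group_language (option I + V * unit),
    forall (G : groupType) (p : option I -> G) (L : fieldType) (c : L -> G),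
      field_code p c -> forall e : V -> L,
      @holds _ (group_structure G) _ (join p (fun x => c (e x.1))) psi <->
      @holds _ (ring_structure L) _ e phi.
Proof.
have dP U (w : option I) : tdefinable (M := fun s => group_structure (cgroup s))
    (fun s (e : option I + U -> cgroup s) => (e \o inl) w).
  exact: (tdef_var _ (inl w)).
have dV U (u : U) : tdefinable (M := fun s => group_structure (cgroup s))
    (fun s (e : option I + U -> cgroup s) => e (inr u)).
  exact: (tdef_var _ (inr u)).
have [delta Hdelta] : definable (M := fun s => group_structure (cgroup s))
    (fun s (e : option I + unit -> cgroup s) => is_true (is_coord (e \o inl) (e (inr tt)))).
  exact: def_is_coord.
have [||f|psi Hpsi] := @interpretation ring_language group_language coordinatized
  (fun s => ring_structure (cfield s)) (fun s => group_structure (cgroup s))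
  unit (option I) (fun s a _ => @ccode s a) cparam delta _ _ _ _ phi.
- move=> s m; rewrite Hdelta /=; case: (ccodeP s) => _ Hcoord _ _ _.
  rewrite Hcoord; split=> -[a Ha]; exists a; last by rewrite -Ha.
  by apply: functional_extensionality => -[].
- move=> s a b ab; case: (ccodeP s) => c_inj _ _ _ _; apply: c_inj.
  exact: (congr1 (fun h => h tt) ab).
- suff [g [dg Hg]] : exists g : forall s, (option I + option 'I_(arity f) * unit -> cgroup s) -> cgroup s,
      tdefinable (M := fun s => group_structure (cgroup s)) g /\
      forall s (e : option 'I_(arity f) -> cfield s),
        g s (join (@cparam s) (fun x => ccode (e x.1))) =
        ccode (interp (s := ring_structure (cfield s)) (e \o Some)).
    have [phi' Hphi'] := def_eq (dV _ (None, tt)) dg.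
    exists phi' => s e; rewrite Hphi' /= Hg; split=> [|->//].
    by case: (ccodeP s) => c_inj _ _ _ _ /c_inj.
  case: f.
  + exists (fun s _ => 1%g); split=> [|s e]; first exact: gdef_1.
    by rewrite -(field_code0 (ccodeP s)).
  + exists (fun s e => unt (e \o inl)); split=> [|s e]; first exact: gdef_unt.
    by case: (ccodeP s) => _ _ <-.
  + exists (fun s e => (e (inr (Some ord0, tt)))^-1%g); split=> [|s e].
      exact: gdef_inv.
    by rewrite -(field_codeN _ (ccodeP s)).
  + exists (fun s e => e (inr (Some ord0, tt)) * e (inr (Some ord_max, tt)))%g.
    split=> [|s e]; first exact: gdef_mul.
    by case: (ccodeP s) => _ _ _ <-.
  + exists (fun s e => rmul (e \o inl) (e (inr (Some ord0, tt))) (e (inr (Some ord_max, tt)))).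
    split=> [|s e]; first exact: gdef_rmul.
    by case: (ccodeP s) => _ _ _ _ <-.
exists psi => G p L c cP e.
by have := Hpsi (Coordinatized cP) e.
Qed.

Section Words.
Variable s : seq I.
Local Notation N := (size s).

Definition wordG (G : groupType) (p : option I -> G) (t : 'I_N -> G) : G :=
  (\prod_(k < N) rootelt p (tnth (in_tuple s) k) (t k))%g.

Definition wordM (F : fieldType) (t : 'I_N -> F) : SL n.+3 F :=
  (\prod_(k < N) transv (tnth (in_tuple s) k) (t k))%g.

(** The three families of coefficients are indexed by the elements of ['I_3]. *)
Definition word_relation (F : fieldType) (t : 'I_3 * 'I_N -> F) : Prop :=
  (wordM (fun k => t (ix0 0, k)) * wordM (fun k => t (ix1 0, k)))%g =
  wordM (fun k => t (ixm 0, k)).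

Lemma rdef_wordM_entry x i j :
  tdefinable (M := fun F : fieldType => ring_structure F)
    (fun F (t : 'I_3 * 'I_N -> F) => wordM (fun k => t (x, k)) i j).
Proof.
rewrite /wordM; elim: (index_enum 'I_N) i j => [|k r IH] i j.
  by apply: tdef_ext (rdef_bool _ (i == j)) => F t; rewrite big_nil mxE.
have dcons : tdefinable (M := fun F : fieldType => ring_structure F)
    (fun F (t : 'I_3 * 'I_N -> F) => (transv (tnth (in_tuple s) k) (t (x, k)) *m
       SLval (\prod_(k <- r) transv (tnth (in_tuple s) k) (t (x, k)))%g) i j).
  apply: rdef_mulmx => {}i {}j; last exact: IH.
  case: (tnth _ k) => i' j'.
  have dentry : tdefinable (M := fun F : fieldType => ring_structure F)
      (fun F (t : 'I_3 * 'I_N -> F) =>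
        (i == j)%:R + t (x, k) * ((i' != j') && ((i == i') && (j == j')))%:R).
    by apply: rdef_add; [exact: rdef_bool|apply: rdef_mul; [exact: tdef_var|exact: rdef_bool]].
  apply: tdef_ext dentry => F t; rewrite !mxE /=.
  by case: (i' != j'); rewrite ?mulr1n ?mulr0n ?mul0r ?mulr0.
by apply: tdef_ext dcons => F t; rewrite big_cons.
Qed.

Lemma def_word_relation :
  definable (M := fun F : fieldType => ring_structure F) word_relation.
Proof.
have dentries : definable (M := fun F : fieldType => ring_structure F)
    (fun F (t : 'I_3 * 'I_N -> F) => forall i j,
      (SLval (wordM (fun k => t (ix0 0, k))) *m wordM (fun k => t (ix1 0, k))) i j =
      wordM (fun k => t (ixm 0, k)) i j).
  apply: def_forall_fin => i; apply: def_forall_fin => j; apply: def_eq.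
    by apply: rdef_mulmx => {}i {}j; apply: rdef_wordM_entry.
  exact: rdef_wordM_entry.
apply: def_ext dentries => F t; rewrite /word_relation; split=> [H|H i j].
  by apply: val_inj; apply/matrixP.
by rewrite -[in RHS]H.
Qed.

Variable psi : formula group_language (option I + ('I_3 * 'I_N) * unit).
Hypothesis psiP : forall (G : groupType) (p : option I -> G) (L : fieldType) (c : L -> G),
  field_code p c -> forall t : 'I_3 * 'I_N -> L,
  @holds _ (group_structure G) _ (join p (fun x => c (t x.1))) psi <-> word_relation t.

(** In a group with a coordinate field [psi] expresses [word_relation], so the
   second clause compares products of words in the group and over the field. *)
Definition presented (G : groupType) (p : option I -> G) : Prop :=
  (forall g : G, exists t : 'I_N -> G, (forall k, is_coord p (t k)) /\ g = wordG p t) /\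
  (forall t : 'I_3 * 'I_N -> G, (forall x, is_coord p (t x)) ->
    ((wordG p (fun k => t (ix0 0, k)) * wordG p (fun k => t (ix1 0, k)))%g =
      wordG p (fun k => t (ixm 0, k)) <->
     @holds _ (group_structure G) _ (join p (fun x => t x.1)) psi)).

Lemma def_presented :
  definable (M := fun G : groupType => group_structure G) presented.
Proof.
apply: def_and.
  apply: def_all; apply: def_ex_fin; apply: def_and.
    by apply: def_forall_fin => k; gdefs.
  by apply: def_eq; gdefs; apply: gdef_prod => k; gdefs.
apply: def_all_fin; apply: def_imp; first by apply: def_forall_fin => x; gdefs.
apply: def_iff.
  by apply: def_eq; gdefs; apply: gdef_prod => k; gdefs.
pose r (x : option I + ('I_3 * 'I_N) * unit) : option I + 'I_3 * 'I_N :=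
  match x with inl w => inl w | inr y => inr y.1 end.
apply: def_ext (def_holds_rename _ r psi) => G e.
by have -> : (e \o r) = join (e \o inl) (fun x => (e \o inr) x.1)
  by apply: functional_extensionality; case.
Qed.

(** Send a word in the root elements to the same word in the transvections.  The
   relations [w0 * w1 = w2] decide equality of words as well, by taking for [w1]
   a word for the identity, so this is well defined and injective. *)
Lemma presented_iso (G : groupType) (p : option I -> G) (L : fieldType) (c : L -> G) :
  (forall A : SL n.+3 L, exists t, A = wordM t) ->
  field_code p c -> presented p -> group_isomorphic G (SL n.+3 L).
Proof.
move=> gen cP [Pgen Prel]; have Pgen' (g : G) : exists t : 'I_N -> L, g = wordG p (c \o t).
  have [t [dt ->]] := Pgen g.
  have [|t' Ht'] := @fin_all_exists _ _ (fun k a => c a = t k).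
    by move=> k; case: (cP) => _ dP _ _ _; apply/dP.
  by exists t'; apply: eq_bigr => k _; rewrite /= Ht'.
have rel (t0 t1 t2 : 'I_N -> L) :
    (wordG p (c \o t0) * wordG p (c \o t1))%g = wordG p (c \o t2) <->
    (wordM t0 * wordM t1)%g = wordM t2.
  pose t (x : 'I_3 * 'I_N) : L :=
    if x.1 == ix0 0 then t0 x.2 else if x.1 == ix1 0 then t1 x.2 else t2 x.2.
  have := Prel (c \o t) (fun x => field_code_coord (t x) cP).
  by rewrite (psiP cP).
have [e0 e0E] := Pgen' 1%g.
have e0M : wordM e0 = 1%g.
  by apply: (mulgI (wordM e0)); rewrite mulg1; apply/rel; rewrite -e0E mulg1.
have word_eq (t t' : 'I_N -> L) :
    wordG p (c \o t) = wordG p (c \o t') <-> wordM t = wordM t'.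
  have := rel t e0 t'.
  by rewrite -e0E e0M !mulg1.
have [tG tGE] := functional_choice _ Pgen'.
have [tM tME] := functional_choice _ gen.
pose f (g : G) : SL n.+3 L := wordM (tG g).
have fM : {morph f : x y / (x * y)%g}.
  by move=> x y; symmetry; apply/rel; rewrite -!tGE.
pose f' : {multiplicative G -> SL n.+3 L} :=
  HB.pack f (isMultiplicative.Build G (SL n.+3 L) f fM).
exists f'; exists (fun A => wordG p (c \o tM A)) => [g|A] /=.
  by rewrite {2}(tGE g); apply/word_eq; rewrite -tME.
by rewrite /f [RHS]tME; apply/word_eq; rewrite -tGE.
Qed.

End Words.
End CoordinateInterpretation.

(** * Relations between transvections *)

Section TransvectionRelations.
Variables (n : nat) (F : fieldType).
Implicit Types (i j k l : 'I_n) (a b : F) (A : SL n F).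

Lemma SLmulE A B : SLval (A * B)%g = A *m B.
Proof. by []. Qed.

Lemma transv_commute i j k l a b : i != j -> k != l -> j != k -> i != l ->
  (transv (i, j) a * transv (k, l) b = transv (k, l) b * transv (i, j) a)%g.
Proof.
move=> ij kl jk il; apply: val_inj => /=; rewrite /transv_mx ij kl !mulr1n.
rewrite !mulmxDl !mulmxDr !mul1mx !mulmx1 -!scalemxAl -!scalemxAr !mul_delta_mx_cond.
rewrite (negPf jk) [l == i]eq_sym (negPf il) !mulr0n !scaler0 !addr0.
by rewrite -!addrA [X in _ + X = _]addrC.
Qed.

(** Only the difference of [P *m Q] and [Q *m P] matters.  For elementary matrices
   the second product vanishes; after the inverse transpose automorphism the
   first one does. *)
Lemma heisenberg_mx (P Q N : 'M[F]_n) a b :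
  N *m P = 0 -> N *m Q = 0 -> P *m Q = N + Q *m P ->
  (1%:M + a *: P) *m (1%:M + b *: Q) =
  (1%:M + (a * b) *: N) *m (1%:M + b *: Q) *m (1%:M + a *: P).
Proof.
move=> NP NQ PQ.
have -> : (1%:M + (a * b) *: N) *m (1%:M + b *: Q) = 1%:M + (a * b) *: N + b *: Q.
  by rewrite mulmxDr mulmx1 -scalemxAr mulmxDl mul1mx -scalemxAl NQ scaler0 addr0.
rewrite !mulmxDr !mulmx1 -!scalemxAr !mulmxDl !mul1mx -!scalemxAl NP PQ.
move: (Q *m P) => T; apply/matrixP => i j; rewrite !mxE; ring.
Qed.

Lemma transv_commutator i j k a b : i != j -> j != k -> i != k ->
  (transv (i, j) a * transv (j, k) b =
   transv (i, k) (a * b) * transv (j, k) b * transv (i, j) a)%g.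
Proof.
move=> ij jk ik; apply: val_inj => /=; rewrite /transv_mx ij jk ik !mulr1n.
have [ji ki kj] : [/\ j != i, k != i & k != j] by rewrite ![_ == i]eq_sym ![k == _]eq_sym.
apply: heisenberg_mx; rewrite ?mul_delta_mx_cond.
- by rewrite (negPf ki) mulr0n.
- by rewrite (negPf kj) mulr0n.
- by rewrite eqxx (negPf ki) mulr0n addr0.
Qed.

Lemma mul_delta_entry (A : 'M[F]_n) i j x y : (A *m delta_mx i j) x y = A x i * (y == j)%:R.
Proof.
rewrite mxE (bigD1 i) //= mxE eqxx /= big1 ?addr0 // => k ki.
by rewrite mxE (negPf ki) mulr0.
Qed.

Lemma delta_mul_entry (A : 'M[F]_n) i j x y : (delta_mx i j *m A) x y = (x == i)%:R * A j y.
Proof.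
rewrite mxE (bigD1 j) //= mxE eqxx andbT big1 ?addr0 // => k kj.
by rewrite mxE (negPf kj) andbF mul0r.
Qed.

Lemma transv_exp (ij : 'I_n * 'I_n) a (m : nat) :
  (transv ij a ^+ m = transv ij (a *+ m))%g.
Proof.
elim: m => [|m IH]; first by rewrite mulr0n transv0.
by rewrite expgS IH mulrS transvD.
Qed.

Lemma transv_inj i j : i != j -> injective (fun a : F => transv (i, j) a).
Proof.
move=> ij a b /(congr1 (fun A : SL n F => A i j)); rewrite /= /transv_mx ij !mulr1n !mxE.
by rewrite (negPf ij) !add0r !eqxx !mulr1.
Qed.

Lemma cnj_eqP (G : groupType) (g x y : G) : (g * x = y * g)%g -> cnj g x = y.
Proof. by rewrite /cnj => ->; rewrite mulgK. Qed.

(** The determinant of the permutation matrix is corrected by scaling a row [k]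
   that meets neither of the two root positions. *)
Lemma transv_conjugator i j k l : (2 < n)%N -> i != j -> k != l ->
  exists g : SL n F, forall a, cnj g (transv (i, j) a) = transv (k, l) a.
Proof.
move=> n3 ij kl.
have [h [hk hl]] : exists h, h != k /\ h != l.
  have : (0 < #|~: [set k; l]|)%N.
    by rewrite cardsCs setCK cards2 card_ord; case: (k != l); rewrite subn_gt0 // ltnW.
  by case/card_gt0P => h; rewrite !inE negb_or => /andP[]; exists h.
pose s0 := tperm k i.
pose s := (s0 * tperm (s0 l) j)%g.
have s0k : s0 k = i by rewrite tpermL.
have s0l : s0 l != i by rewrite -s0k (inj_eq perm_inj) eq_sym.
have sk : s k = i by rewrite permM s0k tpermD // eq_sym.
have sl : s l = j by rewrite permM tpermL.
pose d : 'rV[F]_n := \row_x (if x == h then (-1) ^+ s else 1).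
pose m := diag_mx d *m perm_mx s.
have mE x y : m x y = d 0 x * (s x == y)%:R by rewrite /m mul_diag_mx !mxE.
have det_m : \det m == 1.
  rewrite det_mulmx det_diag det_perm (bigD1 h) //= mxE eqxx big1 => [|x xh].
    by rewrite mulr1 -expr2 sqrr_sign.
  by rewrite mxE (negPf xh).
exists (MkSL det_m) => a; apply: cnj_eqP; apply: val_inj => /=.
rewrite /transv_mx ij kl !mulr1n mulmxDr mulmxDl mulmx1 mul1mx; congr (_ + _).
rewrite -scalemxAr -scalemxAl; congr (_ *: _); apply/matrixP => x y.
rewrite mul_delta_entry delta_mul_entry !mE sl !mxE.
rewrite -{1}sk (inj_eq perm_inj) [l == h]eq_sym (negPf hl) [j == y]eq_sym.
have [->|_] := eqVneq x k; last by rewrite mulr0 !mul0r.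
by rewrite [k == h]eq_sym (negPf hk) !mul1r.
Qed.

Lemma transv_scale i j k a b : i != j -> k != i -> k != j -> b != 0 ->
  exists g : SL n F, cnj g (transv (i, j) a) = transv (i, j) (b * a).
Proof.
move=> ij ki kj b0.
pose d : 'rV[F]_n := \row_x (if x == i then b else if x == k then b^-1 else 1).
have det_d : \det (diag_mx d) == 1.
  rewrite det_diag (bigD1 i) //= (bigD1 k) //= big1 => [|x /andP[xi xk]].
    by rewrite !mxE !eqxx (negPf ki) mulr1 divff.
  by rewrite mxE (negPf xi) (negPf xk).
exists (MkSL det_d); apply: cnj_eqP; apply: val_inj => /=.
rewrite /transv_mx ij !mulr1n mulmxDr mulmxDl mulmx1 mul1mx; congr (_ + _).
rewrite -scalemxAr -scalemxAl; apply/matrixP => x y.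
rewrite [LHS]mxE [RHS]mxE mul_delta_entry delta_mul_entry !mxE.
have [_|_] := eqVneq x i; last by rewrite ?mulr0n !(mulr0, mul0r).
rewrite [j == y]eq_sym; have [_|_] := eqVneq y j; last by rewrite ?mulr0n !mulr0.
by rewrite [j == i]eq_sym (negPf ij) [j == k]eq_sym (negPf kj) !mulr1n !mulr1 mulrC.
Qed.

End TransvectionRelations.

(** * The standard coordinates of SL *)

Section StandardCoordinates.
Variables (n : nat) (F : fieldType).
Local Notation I := ('I_n.+3 * 'I_n.+3)%type.
Local Notation G := (SL n.+3 F).
Local Notation i0 := (ix0 n).
Local Notation i1 := (ix1 n).
Local Notation im := (ixm n).

Lemma neq01 : i0 != i1. Proof. by []. Qed.
Lemma neq1m : i1 != im. Proof. by []. Qed.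
Lemma neq0m : i0 != im. Proof. by []. Qed.

Lemma mx_commute_transv (z : G) i j : i != j ->
  (z * transv (i, j) 1 = transv (i, j) 1 * z)%g ->
  forall x y, z x i * (y == j)%:R = (x == i)%:R * z j y.
Proof.
move=> ij /(congr1 (@SLval _ _)) /=; rewrite /transv_mx ij mulr1n scale1r.
rewrite mulmxDr mulmxDl mulmx1 mul1mx => /addrI H x y.
by rewrite -mul_delta_entry H delta_mul_entry.
Qed.

(** The first condition makes all rows of [z] but the first scalar, and the second
   does the same for all columns but the last. *)
Lemma commute_root_rays (z : G) :
  (forall j, j != i0 -> (z * transv (i0, j) 1 = transv (i0, j) 1 * z)%g) ->
  (forall i, i != im -> (z * transv (i, im) 1 = transv (i, im) 1 * z)%g) ->
  exists (u : G) a, (forall g, (u * g = g * u)%g) /\ z = (u * transv (i0, im) a)%g.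
Proof.
move=> H0 Hm.
have E0 j (j0 : j != i0) x y : z x i0 * (y == j)%:R = (x == i0)%:R * z j y.
  by apply: mx_commute_transv; rewrite 1?eq_sym // H0.
have Em i (im' : i != im) x y : z x i * (y == im)%:R = (x == i)%:R * z im y.
  by apply: mx_commute_transv; rewrite // Hm.
pose mu := z i0 i0.
have zrow j y : j != i0 -> z j y = mu * (y == j)%:R.
  by move=> j0; rewrite E0 // eqxx mul1r.
have zcol x i : i != im -> z x i = mu * (x == i)%:R.
  move=> im'; have := Em i im' x im; rewrite eqxx mulr1 => ->.
  by rewrite mulrC (zrow im) // eqxx mulr1.
have mu0 : mu != 0.
  apply: contraTneq (SL_unitmx z) => mu0.
  rewrite unitmxE unitfE negbK (expand_det_row _ im) big1 // => j _.
  by rewrite zrow // mu0 !mul0r.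
pose t := transv (i0, im) (z i0 im / mu) : G.
have zE : SLval z = mu *: SLval t.
  apply/matrixP => x y; rewrite /= /transv_mx /= mulr1n !mxE.
  have [->|ym] := eqVneq y im; last first.
    by rewrite zcol // andbF mulr0 addr0.
  have [->|x0] := eqVneq x i0; last by rewrite zrow // mulr0 addr0 [im == _]eq_sym.
  by rewrite (_ : i0 == im = false) // add0r mulr1 mulrC divfK.
exists (z * t^-1)%g, (z i0 im / mu); split=> [g|]; last by rewrite mulgVK.
have uE : SLval (z * t^-1)%g = mu%:M.
  by rewrite SLmulE zE -scalemxAl -(SLmulE t t^-1%g) mulgV scalemx1.
apply: val_inj; rewrite [LHS](SLmulE (z * t^-1)%g g) [RHS](SLmulE g (z * t^-1)%g) uE.
by rewrite scalar_mxC.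
Qed.

Variable p : option I -> G.
Hypothesis p_unt : unt p = transv (i0, im) 1.
Hypothesis p_root : forall i j, i != j -> forall a,
  rootelt p (i, j) (transv (i0, im) a) = transv (i, j) a.

Lemma std_rmul a b :
  rmul p (transv (i0, im) a) (transv (i0, im) b) = transv (i0, im) (a * b).
Proof.
by rewrite /rmul !p_root // (@transv_commutator _ _ i0 i1 im) // !mulgK.
Qed.

Lemma std_code : field_code p (transv (i0, im)).
Proof.
split; first exact: transv_inj.
- move=> z; rewrite is_coordP p_unt; split=> [[H0 [Hm Hz]]|[a <-]].
    have [j j0|i im'|u [a [uC def_z]]] := @commute_root_rays z.
    + by rewrite -p_root 1?eq_sym // H0.
    + by rewrite -p_root // Hm.
    exists a; rewrite -Hz def_z -[in LHS](mulr1 a) -std_rmul /rmul.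
    have uroot ij x : rootelt p ij (u * x)%g = (u * rootelt p ij x)%g.
      by rewrite /rootelt /cnj mulgA -uC -!mulgA.
    rewrite uroot; move: (rootelt _ _ _) (rootelt _ _ _) => y x.
    rewrite invgM -(mulgA u x y) uC -!mulgA; congr (_ * (_ * _))%g.
    by rewrite (mulgA u) uC -!mulgA mulVKg.
  split=> [j j0|]; last split=> [i im'|].
  + by rewrite p_root 1?eq_sym // transv_commute // eq_sym.
  + by rewrite p_root // transv_commute // eq_sym.
  + by rewrite std_rmul mulr1.
- by [].
- by move=> a b; rewrite transvD.
- by move=> a b; rewrite std_rmul.
Qed.

Lemma std_coord z : is_coord p z -> exists a, transv (i0, im) a = z.
Proof. by case: std_code => _ dP _ _ _ /dP. Qed.

Lemma std_steinberg : steinberg p.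
Proof.
split=> [x /std_coord[a <-]|]; first by rewrite p_root.
move=> i j k l ij kl il x y /std_coord[a <-] /std_coord[b <-].
rewrite std_rmul !p_root //; case: (eqVneq j k) kl => [<- jl|jk kl].
  exact: transv_commutator.
exact: transv_commute.
Qed.

Lemma std_unipotence charF :
  (if charF is Some r then is_true (r \in [pchar F]) else [pchar F] =i pred0) ->
  unipotence p charF.
Proof.
move=> charFP x /std_coord[a <-]; case: charF charFP => [r rF|F0].
  by rewrite transv_exp -mulr_natl (pcharf0 rF) mul0r transv0.
move=> k k0; rewrite transv_exp -mulr_natl.
apply: (@transv_scale _ _ i0 im i1) => //.
by move/pcharf0P: F0 => ->; rewrite -lt0n.
Qed.

Lemma std_presented (s : seq I) psi :
  (forall (G : groupType) (p : option I -> G) (L : fieldType) (c : L -> G),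
    field_code p c -> forall t : 'I_3 * 'I_(size s) -> L,
    @holds _ (group_structure G) _ (join p (fun x => c (t x.1))) psi <-> word_relation t) ->
  all (fun ij => ij.1 != ij.2) s ->
  (forall A : G, exists t : 'I_(size s) -> F, A = wordM t) ->
  presented psi p.
Proof.
move=> psiP /allP s_neq gen.
have wordE (t : 'I_(size s) -> F) : wordG p (fun k => transv (i0, im) (t k)) = wordM t.
  apply: eq_bigr => k _; have := s_neq _ (mem_tnth k (in_tuple s)).
  by case: (tnth _ k) => i j /= ij; rewrite p_root.
split=> [g|t dt].
  have [t ->] := gen g; exists (fun k => transv (i0, im) (t k)); split=> [k|].
    exact: field_code_coord std_code.
  by rewrite wordE.
have [t' def_t] : exists t', forall x, transv (i0, im) (t' x) = t x.
  by apply: (@fin_all_exists _ _ (fun x a => transv (i0, im) a = t x)) => x; apply: std_coord.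
have {def_t} -> : t = fun x => transv (i0, im) (t' x).
  exact: functional_extensionality.
by rewrite (psiP _ _ _ _ std_code) /word_relation !wordE.
Qed.

End StandardCoordinates.

Lemma std_params_exist n (F : fieldType) :
  exists p : option ('I_n.+3 * 'I_n.+3) -> SL n.+3 F,
    unt p = transv (ix0 n, ixm n) 1 /\
    forall i j, i != j -> forall a,
      rootelt p (i, j) (transv (ix0 n, ixm n) a) = transv (i, j) a.
Proof.
have [|m Hm] := @fin_all_exists _ _ (fun (ij : 'I_n.+3 * 'I_n.+3) (g : SL n.+3 F) =>
    ij.1 != ij.2 -> forall a, cnj g (transv (ix0 n, ixm n) a) = transv ij a).
  case=> i j /=; have [_|ij] := eqVneq i j; first by exists 1%g.
  have [g Hg] := @transv_conjugator _ F (ix0 n) (ixm n) i j isT isT ij.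
  by exists g => _.
exists (fun w => if w is Some ij then m ij else transv (ix0 n, ixm n) 1).
by split=> // i j ij a; apply: (Hm (i, j)).
Qed.

(** * Every frame of SL over F codes F *)

Local Opaque is_coord.

Section Rigidity.
Variables (n : nat) (F : fieldType).
Local Notation I := ('I_n.+3 * 'I_n.+3)%type.
Local Notation G := (SL n.+3 F).
Local Notation i0 := (ix0 n).
Local Notation i1 := (ix1 n).
Local Notation im := (ixm n).
Variables (p : option I -> G) (charF : option nat).
Hypothesis charFP : if charF is Some r then is_true (r \in [pchar F]) else [pchar F] =i pred0.
Hypothesis p_field : field_axioms p.
Hypothesis p_steinberg : steinberg p.
Hypothesis p_unip : unipotence p charF.

Lemma cnj_exp (H : groupType) (g x : H) k : (cnj g x ^+ k = cnj g (x ^+ k))%g.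
Proof.
rewrite /cnj; elim: k => [|k IH]; first by rewrite !expg0 mulg1 mulgV.
by rewrite !expgS IH !mulgA mulgVK.
Qed.

Lemma SLval_exp (A : G) k : SLval (A ^+ k)%g = SLval A ^+ k.
Proof. by elim: k => [|k IH] //; rewrite expgS exprS -IH. Qed.

Lemma mxtrace_cnj (g A : G) : \tr (SLval (cnj g A)) = \tr (SLval A).
Proof.
by rewrite /cnj SLmulE mxtrace_mulC -(SLmulE g^-1%g) mulKg.
Qed.

(** In characteristic zero, conjugacy of [x] with its powers makes the traces of
   these powers equal. *)
Lemma rootelt_unipotent ij x : is_coord p x ->
  exists k, (SLval (rootelt p ij x) - 1%:M) ^+ k = 0.
Proof.
move=> dx; have := p_unip dx; case: charF charFP => [r rF xr|F0 conj_x].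
  exists r; have rM : r \in [pchar 'M[F]_n.+3].
    rewrite inE (pcharf_prime rF) /=.
    by rewrite -(rmorph_nat (@scalar_mx F n.+3)) (pcharf0 rF) raddf0.
  rewrite -(pFrobenius_autE rM) pFrobenius_autB_comm; last exact: commr1.
  rewrite pFrobenius_aut1 pFrobenius_autE -SLval_exp cnj_exp xr.
  by rewrite /cnj mulg1 mulgV subrr.
apply: (unipotent_of_power_traces (tau := \tr (SLval x)) F0); first exact: SL_unitmx.
move=> j /andP[j0 jn]; rewrite -SLval_exp cnj_exp mxtrace_cnj.
have [g <-] := conj_x (Ordinal (jn : (j < n.+4.+1)%N)) j0.
exact: mxtrace_cnj.
Qed.

Lemma unt_coord : is_coord p (unt p). Proof. by case: p_field => _ []. Qed.

Lemma rmul1r x : is_coord p x -> rmul p x (unt p) = x.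
Proof. by move=> /is_coordP[_ []]. Qed.

Lemma ord_lt_neq m (i j : 'I_m) : (i < j)%N -> i != j.
Proof. by move=> ij; rewrite -val_eqE /= ltn_eqF. Qed.

Lemma steinberg_commute i j k l x y : i != j -> k != l -> j != k -> i != l ->
  is_coord p x -> is_coord p y ->
  (rootelt p (i, j) x * rootelt p (k, l) y = rootelt p (k, l) y * rootelt p (i, j) x)%g.
Proof.
move=> ij kl jk il dx dy; case: p_steinberg => _ /(_ i j k l ij kl il x y dx dy).
by rewrite (negPf jk).
Qed.

Lemma steinberg_commutator i j k x y : i != j -> j != k -> i != k ->
  is_coord p x -> is_coord p y ->
  (rootelt p (i, j) x * rootelt p (j, k) y =
   rootelt p (i, k) (rmul p x y) * rootelt p (j, k) y * rootelt p (i, j) x)%g.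
Proof.
move=> ij jk ik dx dy; case: p_steinberg => _ /(_ i j j k ij jk ik x y dx dy).
by rewrite eqxx.
Qed.

Section Unitriangular.
Variable t : G.
Hypothesis dt : is_coord p t.

(** Two copies of the first row of root elements, one with parameter [t], so
   that the commutators of both copies are compared inside one flag. *)
Definition tri_index := (bool * I)%type.
Definition tri_param (a : tri_index) : G := if a.1 && (a.2.1 == i0) then t else unt p.
Definition tri_elt (a : tri_index) : 'M[F]_n.+3 := rootelt p a.2 (tri_param a).
Definition tri_height (a : tri_index) : nat := (a.2.2 - a.2.1)%N.
Definition tri_set : {set tri_index} := [set a : tri_index | (a.2.1 < a.2.2)%N].

Lemma tri_param_coord a : is_coord p (tri_param a).
Proof. by rewrite /tri_param; case: ifP => _; [exact: dt|exact: unt_coord]. Qed.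

Lemma tri_commutator b b' (i j k : 'I_n.+3) : (i < j)%N -> (j < k)%N ->
  tri_elt (b, (i, j)) *m tri_elt (b', (j, k)) =
  tri_elt (b, (i, k)) *m tri_elt (b', (j, k)) *m tri_elt (b, (i, j)).
Proof.
move=> ij jk; have ik := ltn_trans ij jk.
have -> : tri_elt (b', (j, k)) = rootelt p (j, k) (unt p).
  rewrite /tri_elt /tri_param /= (_ : j == i0 = false) ?andbF //.
  by rewrite -val_eqE /= gtn_eqF // (leq_ltn_trans _ ij).
have [x [dx -> ->]] : exists x, [/\ is_coord p x,
    tri_elt (b, (i, j)) = rootelt p (i, j) x & tri_elt (b, (i, k)) = rootelt p (i, k) x].
  by exists (tri_param (b, (i, j))); split; first exact: tri_param_coord.
rewrite -!SLmulE; congr SLval.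
rewrite (steinberg_commutator (ord_lt_neq ij) (ord_lt_neq jk) (ord_lt_neq ik) dx unt_coord).
by rewrite (rmul1r dx).
Qed.

Lemma tri_comm a b : a \in tri_set -> b \in tri_set ->
  tri_elt a *m tri_elt b = tri_elt b *m tri_elt a \/
  exists c, [/\ c \in tri_set, (tri_height a < tri_height c)%N &
    tri_elt a *m tri_elt b = tri_elt c *m tri_elt b *m tri_elt a \/
    tri_elt b *m tri_elt a = tri_elt c *m tri_elt a *m tri_elt b].
Proof.
case: a b => [b [i j]] [b' [k l]]; rewrite !inE /= => ij kl.
have [jk|jk] := eqVneq j k.
  rewrite -jk in kl *; right; exists (b, (i, l)); rewrite inE /tri_height /=.
  split; [exact: ltn_trans ij kl|lia|left; exact: tri_commutator].
have [il|il] := eqVneq i l.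
  rewrite -il in kl *; right; exists (b', (k, j)); rewrite inE /tri_height /=.
  split; [exact: ltn_trans kl ij|lia|right; exact: tri_commutator].
left; rewrite /tri_elt -!SLmulE; congr SLval.
exact: (steinberg_commute (ord_lt_neq ij) (ord_lt_neq kl) jk il
  (tri_param_coord _) (tri_param_coord _)).
Qed.

Lemma tri_gen a : a \in tri_set -> tri_height a = 1%N \/
  exists b c, [/\ b \in tri_set, c \in tri_set, (0 < tri_height b)%N, (0 < tri_height c)%N &
   tri_height a = (tri_height b + tri_height c)%N /\
   tri_elt b *m tri_elt c = tri_elt a *m tri_elt c *m tri_elt b].
Proof.
case: a => [b [i j]]; rewrite inE /tri_height /= => ij.
have [Eij|ltij] := eqVneq (j : nat) i.+1; first by left; rewrite Eij subSnn.
have ij1 : (i.+1 < j)%N by rewrite ltn_neqAle eq_sym ltij.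
right; pose k := Ordinal (ltn_trans ij1 (ltn_ord j)).
exists (b, (i, k)), (false, (k, j)); rewrite !inE /=.
split; [lia|lia|lia|lia|split; first by lia].
by apply: tri_commutator => //=.
Qed.

Lemma tri_unip a : a \in tri_set -> exists k, (tri_elt a - 1%:M) ^+ k = 0.
Proof. by move=> _; apply/rootelt_unipotent/tri_param_coord. Qed.

Lemma tri_unit a : a \in tri_set -> tri_elt a \in unitmx.
Proof. by move=> _; apply: SL_unitmx. Qed.

Lemma tri_top b : (b, (i0, im)) \in tri_set /\ tri_height (b, (i0, im)) = n.+2.
Proof. by rewrite inE /tri_height /= subn0. Qed.

Lemma tri_topE b : tri_elt (b, (i0, im)) = if b then SLval t else SLval (unt p).
Proof.
rewrite /tri_elt /tri_param eqxx andbT; case: p_steinberg => fix_root _.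
by case: b; congr SLval; [exact: fix_root dt|exact: fix_root unt_coord].
Qed.

Lemma coord_proportional : exists z, SLval t - 1%:M = z *: (SLval (unt p) - 1%:M).
Proof.
have [Sa ha] := tri_top false; have [Sb hb] := tri_top true.
have := top_height_proportional tri_unip tri_unit tri_comm tri_gen Sa Sb ha hb.
rewrite !tri_topE; apply; rewrite subr_eq0; apply/eqP => unt1.
by case: p_field => _ [_ [u1 _]]; apply: u1; apply: val_inj.
Qed.

Lemma tri_top_mul0 b : b \in tri_set ->
  (SLval (unt p) - 1%:M) *m (tri_elt b - 1%:M) = 0.
Proof.
move=> Sb; have [Sa ha] := tri_top false; rewrite -(tri_topE false).
apply: (top_height_mul0 tri_unip tri_unit tri_comm tri_gen Sa Sb ha).
by move: Sb; rewrite inE /tri_height subn_gt0.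
Qed.

End Unitriangular.

Local Notation root_nil ij := (SLval (rootelt p ij (unt p)) - 1%:M).
Local Notation N := (SLval (unt p) - 1%:M).

Lemma nil_mul0 (i j : 'I_n.+3) : (i < j)%N -> N *m root_nil (i, j) = 0.
Proof.
move=> ij; have /= := @tri_top_mul0 _ unt_coord (false, (i, j)).
by rewrite inE /tri_elt /tri_param /=; apply.
Qed.

Local Notation P := (root_nil (i0, i1)).
Local Notation Q := (root_nil (i1, im)).

Lemma N_neq0 : N != 0.
Proof.
rewrite subr_eq0; apply/eqP => unt1.
by case: p_field => _ [_ [u1 _]]; apply: u1; apply: val_inj.
Qed.

Lemma root0m x : is_coord p x -> rootelt p (i0, im) x = x.
Proof. by case: p_steinberg => fix_root _; apply: fix_root. Qed.

Lemma N_mulN : N *m N = 0.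
Proof.
have := @nil_mul0 i0 im isT.
by rewrite (root0m unt_coord).
Qed.

Lemma P_mulQ : P *m Q = N + Q *m P.
Proof.
have := nil_mul0 (isT : (i0 < i1)%N); have := nil_mul0 (isT : (i1 < im)%N).
have := steinberg_commutator (neq01 n) (neq1m n) (neq0m n) unt_coord unt_coord.
rewrite (rmul1r unt_coord) (root0m unt_coord).
move: (rootelt p (i0, i1) _) (rootelt p (i1, im) _) => x y; move: (unt p) => u.
move=> /(congr1 (@SLval _ _)); rewrite !SLmulE.
move: (SLval x) (SLval y) (SLval u) => X Y U XY NY NX.
have NYX : (U - 1%:M) *m (Y *m X) = U - 1%:M.
  have NYE : (U - 1%:M) *m Y = U - 1%:M.
    by apply/eqP; rewrite -subr_eq0 -{2}[U - 1%:M]mulmx1 -mulmxBr NY.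
  rewrite mulmxA NYE.
  by apply/eqP; rewrite -subr_eq0 -{2}[U - 1%:M]mulmx1 -mulmxBr NX.
have {}XY : X *m Y = Y *m X + (U - 1%:M).
  by rewrite XY -NYX mulmxBl mul1mx mulmxA addrC subrK.
rewrite !mulmxBl !mulmxBr !mul1mx !mulmx1 XY.
by move: (Y *m X) => T; apply/matrixP => i j; rewrite !mxE; ring.
Qed.

Lemma nilE ij x : SLval (rootelt p ij x) - 1%:M =
  SLval (p (Some ij)) *m (SLval x - 1%:M) *m SLval (p (Some ij))^-1%g.
Proof.
rewrite /rootelt /cnj !SLmulE; move: (p (Some ij)) => g.
have gV : SLval g *m SLval g^-1%g = 1%:M by rewrite -SLmulE mulgV.
by rewrite mulmxBr mulmx1 mulmxBl gV.
Qed.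

Lemma P_mulP : P *m P = 0.
Proof.
rewrite nilE; move: (p (Some (i0, i1))) => g.
have gV : SLval g^-1%g *m SLval g = 1%:M by rewrite -SLmulE mulVg.
by rewrite !mulmxA -(mulmxA _ (SLval g^-1%g)) gV mulmx1 -(mulmxA _ N N) N_mulN mulmx0 mul0mx.
Qed.

(** By [heisenberg_mx] the matrix is a commutator of invertible matrices. *)
Lemma det_line a : \det (1%:M + a *: N) == 1.
Proof.
have := @heisenberg_mx _ _ P Q N a 1 (@nil_mul0 i0 i1 isT) (@nil_mul0 i1 im isT) P_mulQ.
have -> : 1%:M + 1 *: Q = SLval (rootelt p (i1, im) (unt p)) by rewrite scale1r addrC subrK.
rewrite mulr1; move: (rootelt p (i1, im) _) => y.
move=> /(congr1 determinant); rewrite !det_mulmx (det_SL y) !mulr1 => detP.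
have unitP : (1%:M + a *: P) \in unitmx.
  apply: (proj1 (mulmx1_unit (B := 1%:M - a *: P) _)).
  rewrite mulmxBr mulmx1 mulmxDl mul1mx -scalemxAl -scalemxAr P_mulP !scaler0 addr0.
  by rewrite addrK.
rewrite unitmxE unitfE in unitP.
by apply/eqP/(mulIf unitP); rewrite mul1r -detP.
Qed.

Definition line a : G := MkSL (det_line a).

Lemma root_line ij a : SLval (rootelt p ij (line a)) = 1%:M + a *: root_nil ij.
Proof.
have nil_line : SLval (rootelt p ij (line a)) - 1%:M = a *: root_nil ij.
  rewrite !nilE [SLval (line a)]/= addrAC subrr add0r.
  by rewrite -scalemxAr -scalemxAl.
by rewrite -nil_line addrC subrK.
Qed.

Lemma line1 : line 1 = unt p.
Proof. by apply: val_inj; rewrite /= scale1r addrC subrK. Qed.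

Lemma lineM a b : rmul p (line a) (line b) = line (a * b).
Proof.
rewrite /rmul; have := root_line (i0, i1) a; have := root_line (i1, im) b.
move: (rootelt p (i1, im) (line b)) (rootelt p (i0, i1) (line a)) => y x Hy Hx.
suff -> : (x * y = line (a * b) * y * x)%g by rewrite !mulgK.
apply: val_inj; rewrite /= Hx Hy.
by apply: heisenberg_mx; [exact: nil_mul0|exact: nil_mul0|exact: P_mulQ].
Qed.

Lemma commute_line z a : (unt p * z = z * unt p)%g -> (line a * z = z * line a)%g.
Proof.
move=> /(congr1 (@SLval _ _)); rewrite !SLmulE => uz; apply: val_inj => /=.
rewrite mulmxDl mulmxDr mul1mx mulmx1 -scalemxAl -scalemxAr.
by rewrite mulmxBl mulmxBr uz mul1mx mulmx1.
Qed.

(** All coordinate elements lie on [line] by [coord_proportional].  Conversely the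
   elements of [line] commute with whatever commutes with [unt p], and the
   multiplication [rmul] on [line] is computed by [heisenberg_mx]. *)
Theorem rigid_code : field_code p line.
Proof.
split.
- move=> a b /(congr1 (@SLval _ _)) /addrI /eqP.
  by rewrite -subr_eq0 -scalerBl scaler_eq0 (negPf N_neq0) orbF subr_eq0 => /eqP.
- move=> z; split=> [dz|[a <-]].
    have [a za] := coord_proportional dz; exists a; apply: val_inj => /=.
    by rewrite -za addrC subrK.
  have /is_coordP[H0 [Hm _]] := unt_coord.
  apply/is_coordP; split=> [j j0|]; first exact/commute_line/H0.
  split=> [i im'|]; first exact/commute_line/Hm.
  by rewrite -{1}line1 lineM mulr1.
- exact: line1.
- move=> a b; apply: val_inj => /=.
  rewrite mulmxDl mul1mx mulmxDr mulmx1 -scalemxAl -scalemxAr N_mulN !scaler0 addr0.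
  by rewrite scalerDl addrA addrAC.
- by move=> a b; rewrite lineM.
Qed.

End Rigidity.

(** * Transfer along elementary equivalence *)

Lemma elem_equiv_definable (G H : groupType)
    (P : forall K : groupType, (void -> K) -> Prop) :
  definable (M := fun K : groupType => group_structure K) P ->
  elem_equiv (group_structure G) (group_structure H) ->
  P G (of_void G) -> P H (of_void H).
Proof. by move=> [phi Hphi] GH /Hphi/GH/Hphi. Qed.

Section Recognition.
Variables (n : nat) (F : fieldType).
Local Notation I := ('I_n.+3 * 'I_n.+3)%type.
Variables (s : seq I) (psi : formula group_language (option I + ('I_3 * 'I_(size s)) * unit)).
Variable charF : option nat.

Definition SL_frame (G : groupType) (p : option I -> G) : Prop :=
  field_axioms p /\ steinberg p /\ unipotence p charF /\ presented psi p.

Lemma def_SL_frame : definable (M := fun G : groupType => group_structure G) SL_frame.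
Proof.
apply: def_and; first exact: def_field_axioms.
apply: def_and; first exact: def_steinberg.
by apply: def_and; [exact: def_unipotence|exact: def_presented].
Qed.

Variable chi : formula group_language (option I + void * unit).

Definition frame_holds (G : groupType) (p : option I -> G) : Prop :=
  @holds _ (group_structure G) _ (join p (fun x => of_void G x.1)) chi.

Let r (x : option I + void * unit) : void + option I :=
  match x with inl w => inr w | inr v => inl v.1 end.

Lemma def_frame_holds : definable (M := fun G : groupType => group_structure G)
  (fun G (e : void + option I -> G) => frame_holds (e \o inr)).
Proof.
apply: def_ext (def_holds_rename _ r chi) => G e; rewrite /frame_holds.
by have -> : e \o r = join (e \o inr) (fun x => of_void G x.1)
  by apply: functional_extensionality => -[|[[]]].
Qed.

Lemma def_frame : definable (M := fun G : groupType => group_structure G)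
  (fun G (e : void + option I -> G) => SL_frame (e \o inr)).
Proof. exact: (def_rename inr def_SL_frame). Qed.

Lemma def_some_frame : definable (M := fun G : groupType => group_structure G)
  (fun G (_ : void -> G) => exists p, SL_frame p /\ @frame_holds G p).
Proof. by apply: def_ex_fin; apply: def_and; [exact: def_frame|exact: def_frame_holds]. Qed.

Lemma def_every_frame : definable (M := fun G : groupType => group_structure G)
  (fun G (_ : void -> G) => forall p, SL_frame p -> @frame_holds G p).
Proof. by apply: def_all_fin; apply: def_imp; [exact: def_frame|exact: def_frame_holds]. Qed.

Lemma def_frame_exists : definable (M := fun G : groupType => group_structure G)
  (fun G (_ : void -> G) => exists p : option I -> G, SL_frame p).
Proof. by apply: def_ex_fin; exact: def_frame. Qed.

End Recognition.

Local Close Scope ring_scope.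

Theorem theoremA2 (F : fieldType) (n : nat) (hn : 3 <= n) (H : groupType) :
  elem_equiv (group_structure H) (group_structure (SL n F)) <->
  exists L : fieldType,
    group_isomorphic H (SL n L) /\
    elem_equiv (ring_structure F) (ring_structure L).
Proof.
case: n hn => [|[|[|n]]] // _; split; last first.
  move=> [L [/group_isomorphic_elem_equiv HL /(@SL_elem_equiv n.+3) FL]] phi.
  by rewrite (HL phi) (FL phi).
move=> HG; have GH phi := iff_sym (HG phi).
have [charF charFP] : exists charF : option nat,
    if charF is Some r then is_true (r \in [pchar F]%R) else [pchar F]%R =i pred0.
  have [[r rF]|noF] := classic (exists r, r \in [pchar F]%R); first by exists (Some r).
  exists None => r; rewrite [RHS]inE; apply/negbTE/negP => rF.
  by apply: noF; exists r.
have [s [s_neq gen]] := bounded_generation n.+3.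
have [wr Hwr] := def_word_relation s.
have [psi Hpsi] := coord_interpretation n wr.
have psiP (G : groupType) (p : option _ -> G) (L : fieldType) (c : L -> G) :
    field_code p c -> forall t : 'I_3 * 'I_(size s) -> L,
    @holds _ (group_structure G) _ (join p (fun x => c (t x.1))) psi <-> word_relation t.
  by move=> cP t; rewrite (Hpsi _ _ _ _ cP) Hwr.
have [p0 [p0_unt p0_root]] := std_params_exist n F.
have frame0 : SL_frame psi charF p0.
  split; first exact: field_axioms_of_code (std_code p0_unt p0_root).
  split; first exact: std_steinberg.
  split; first exact: std_unipotence.
  by apply: std_presented => // A; apply: gen.
have [p [p_field [p_st [p_un p_pres]]]] : exists p : option _ -> H, SL_frame psi charF p.
  apply: (elem_equiv_definable (def_frame_exists psi charF) GH).
  by exists p0.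
have [L [c cP]] := code_of_field_axioms p_field.
exists L; split.
  by apply: presented_iso cP p_pres => // A; apply: gen.
move=> phi; have [chi Hchi] := coord_interpretation n phi.
have frame_field (G : groupType) (q : option _ -> G) (K : fieldType) (d : K -> G) :
    field_code q d -> frame_holds chi q <-> satisfies (ring_structure K) phi.
  move=> dP; rewrite /satisfies -(Hchi _ _ _ _ dP) /frame_holds.
  have -> // : (fun x : void * unit => of_void G x.1) = (fun x => d (of_void K x.1)).
  by apply: functional_extensionality => -[[]].
split=> [Fphi|Lphi].
  apply/(frame_field _ _ _ _ cP).
  apply: (elem_equiv_definable (def_every_frame psi charF chi) GH) => //.
  move=> q [q_field [q_st [q_un _]]].
  by apply/(frame_field _ _ _ _ (rigid_code charFP q_field q_st q_un)).
have [|q [[q_field [q_st [q_un _]]]]] :=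
    elem_equiv_definable (def_some_frame psi charF chi) HG.
  by exists p; split=> //; apply/(frame_field _ _ _ _ cP).
by move/(frame_field _ _ _ _ (rigid_code charFP q_field q_st q_un)).
Qed.
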